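(* Let $\mathcal{P}$ be a unitary set-operad. There is a natural equivalence of categories $$Func(Free(\mathcal{P}), Ab) \simeq PMack(\Omega(\mathcal{P}), Ab),$$ where $Func(Free(\mathcal{P}),Ab)$ is the category of all functors from the category $Free(\mathcal{P})$ of finitely generated free $\mathcal{P}$-algebras to the category $Ab$ of abelian groups, and $PMack(\Omega(\mathcal{P}),Ab)$ is the category of pseudo-Mackey functors.
   Context: Operads. A set-operad $\mathcal{P}$ consists of sets $\mathcal{P}(j)$, $j\ge 0$, with right actions of the symmetric groups $\mathfrak{S}_j$, a unit $1_{\mathcal{P}}\in\mathcal{P}(1)$ and composition maps $\gamma:\mathcal{P}(n)\times\mathcal{P}(m_1)\times\cdots\times\mathcal{P}(m_n)\to\mathcal{P}(m_1+\cdots+m_n)$ that are associative, unital and equivariant in the usual sense. It is unitary if $\mathcal{P}(0)$ has exactly one element, denoted $0_{\mathcal{P}}$. A $\mathcal{P}$-algebra is a set $X$ with maps $\mu_j:\mathcal{P}(j)\times_{\mathfrak{S}_j}X^j\to X$, associative and unital. The free $\mathcal{P}$-algebra on a set $X$ is $\mathcal{F}_{\mathcal{P}}(X)=\coprod_{n\ge0}\mathcal{P}(n)\times_{\mathfrak{S}_n}X^n$. $Free(\mathcal{P})$ is the full subcategory of $\mathcal{P}$-algebras on the objects $\mathcal{F}_{\mathcal{P}}(\underline{n})$, $n\ge0$, where $\underline{n}=\{1,\dots,n\}$. The categories $\mathcal{S}(\mathcal{P})$ and $\Omega(\mathcal{P})$. The objects of $\mathcal{S}(\mathcal{P})$ are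 the sets $\underline{n}$, $n\ge 0$; a morphism $\underline{n}\to\underline{m}$ is a pair $(f,\omega^f)$ with $f:\underline{n}\to\underline{m}$ a map and $\omega^f=(\omega^f_y)_{y}\in\prod_{y\in\underline{m}}\mathcal{P}(|f^{-1}(y)|)$. The composite of $(f,\omega^f):\underline n\to\underline m$ and $(g,\omega^g):\underline m\to\underline l$ is $(g\circ f,\omega^{g\circ f})$ with $\omega^{g\circ f}_i=\gamma(\omega^g_i;\omega^f_{j_1},\dots,\omega^f_{j_s}).\sigma_i$, where $g^{-1}(i)=\{j_1<\dots<j_s\}$ and, if $(x_1,x_2,\dots)$ is the natural ordering of $(g\circ f)^{-1}(i)$ and $(y_1,y_2,\dots)$ is its ordering listing first $f^{-1}(j_1)$ in natural order, then $f^{-1}(j_2)$, etc., then $\sigma_i(k)=l$ where $y_l=x_k$. $\Omega(\mathcal{P})$ is the subcategory with all objects and the morphisms $(f,\omega^f)$ with $f$ surjective. $\Omega$ is the category of the sets $\underline{n}$ and surjective maps. The double category $\Omega(\mathcal{P})_2$. Objects: the $\underline{n}$; horizontal arrows (solid): morphisms of $\Omega$; vertical arrows: morphisms of $\Omega(\mathcal{P})$. A square $\mathcal{D}$ consists of horizontal $f:A\to B$, $g:C\to D$ and vertical $(\phi,\omega^\phi):A\to C$, $(\psi,\omega^\psi):B\to D$ such that $\psi f=g\phi$ is a pullback diagram of sets and, for all $c\in C$, $g_*(\omega^\phi_c)=\omega^\psi_{g(c)}$. Here $g_*$ is the bijection $\mathcal{P}(|\phi^{-1}(c)|)\to\mathcal{P}(|\psi^{-1}(g(c))|)$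 induced by the bijection $\phi^{-1}(c)\to\psi^{-1}(g(c))$ given by $f$: identifying both fibres with some $\underline{r}$ by their natural orders, this is a permutation $h$ of $\underline{r}$, and $g_*(\omega)=\omega.h^{-1}$. Given $g$ and $(\psi,\omega^\psi)$ with common target there is such a square, unique up to isomorphism. The double isomorphisms of $\Omega(\mathcal{P})_2$ are the pairs $(f,u)$ with $f:A\to A$ a bijection and $u=(f,(1_{\mathcal{P}},\dots,1_{\mathcal{P}}))$. Admissible subsets. For $A'\subset A$ with inclusion $i$ (where $A'$ is identified with $\underline{|A'|}$ by the order-preserving bijection), let $f_{A'}=f\circ i$ and $(\phi,\omega^\phi)_{A'}=(\phi,\omega^\phi)\circ(i,\omega^i)$, where $\omega^i_y=1_{\mathcal{P}}$ for $y\in A'$ and $\omega^i_y=0_{\mathcal{P}}$ for $y\notin A'$. $A'$ is $\mathcal{D}$-admissible if $f\circ i$ and $\phi\circ i$ are both surjective; $Adm(\mathcal{D})$ is the set of admissible subsets. Pseudo-Mackey functors. A Janus functor $M:\Omega(\mathcal{P})_2\to Ab$ is a pair of a covariant functor $M_*:\Omega\to Ab$ and a contravariant functor $M^*:\Omega(\mathcal{P})^{op}\to Ab$ with $M_*(A)=M^*(A)=:M(A)$ on objects. It is a pseudo-Mackey functor if (1) $M_*(f)M^*(u)=\mathrm{Id}$ for every double isomorphism $(f,u)$; (2) for every square $\mathcal{D}$ in $\Omega(\mathcal{P})_2$ with horizontal arrows $f:A\to B$, $g:C\to D$ and vertical arrows $(\phi,\omega^\phi):A\to C$, $(\psi,\omega^\psi):B\to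 D$, $M^*(\psi,\omega^\psi)\circ M_*(g)=\sum_{A'\in Adm(\mathcal{D})}M_*(f_{A'})\circ M^*((\phi,\omega^\phi)_{A'})$. $PMack(\Omega(\mathcal{P}),Ab)$ is the category of pseudo-Mackey functors $\Omega(\mathcal{P})_2\to Ab$; morphisms are families of homomorphisms $M(A)\to N(A)$ natural with respect to both $M_*$ and $M^*$. *)

(* Defs.v *)
From HB Require Import structures.
From mathcomp Require Import all_boot all_order all_algebra all_fingroup.
From mathcomp Require Import generic_quotient boolp.

Set Implicit Arguments.
Unset Strict Implicit.
Unset Printing Implicit Defensive.

Import GRing.Theory.

Record category := Category {
  obj :> Type;
  hom : obj -> obj -> Type;
  idh : forall a, hom a a;
  cmp : forall a b c, hom b c -> hom a b -> hom a c;
  cmpA : forall a b c d (h : hom c d) (g : hom b c) (f : hom a b),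
    cmp h (cmp g f) = cmp (cmp h g) f;
  cmp1m : forall a b (f : hom a b), cmp (idh b) f = f;
  cmpm1 : forall a b (f : hom a b), cmp f (idh a) = f
}.
Arguments idh {c} : rename.

Definition opposite (C : category) : category :=
  @Category C (fun a b => hom b a) (fun a => idh a)
    (fun a b c g f => cmp f g)
    (fun a b c d h g f => esym (cmpA f g h))
    (fun a b f => cmpm1 f) (fun a b f => cmp1m f).

Definition full_subcategory (C : category) (I : Type) (F : I -> C) : category :=
  @Category I (fun i j => hom (F i) (F j)) (fun i => idh (F i))
    (fun i j k g f => cmp g f)
    (fun i j k l h g f => cmpA h g f)
    (fun i j f => cmp1m f) (fun i j f => cmpm1 f).

Definition is_functor (C D : category) (F0 : C -> D)
    (F1 : forall a b, hom a b -> hom (F0 a) (F0 b)) : Prop :=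
  (forall a, F1 a a (idh a) = idh (F0 a)) /\
  (forall a b c (g : hom b c) (f : hom a b),
     F1 a c (cmp g f) = cmp (F1 b c g) (F1 a b f)).

Record functor (C D : category) := Functor {
  fobj :> C -> D;
  fmap : forall a b, hom a b -> hom (fobj a) (fobj b);
  functorP : is_functor fmap
}.

Lemma fmap1 (C D : category) (F : functor C D) a : fmap F (idh a) = idh (F a).
Proof. by case: (functorP F). Qed.

Lemma fmap_cmp (C D : category) (F : functor C D) a b c
  (g : hom b c) (f : hom a b) : fmap F (cmp g f) = cmp (fmap F g) (fmap F f).
Proof. by case: (functorP F). Qed.

Lemma id_functorP (C : category) : @is_functor C C id (fun a b f => f).
Proof. by []. Qed.

Definition id_functor (C : category) : functor C C := Functor (id_functorP C).

Lemma comp_functorP (C D E : category) (G : functor D E) (F : functor C D) :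
  @is_functor C E (fun a => G (F a)) (fun a b f => fmap G (fmap F f)).
Proof. by split=> *; rewrite ?fmap1 ?fmap_cmp. Qed.

Definition comp_functor (C D E : category) (G : functor D E) (F : functor C D) :
  functor C E := Functor (comp_functorP G F).

Record nat_trans (C D : category) (F G : functor C D) := NatTrans {
  nt :> forall a, hom (F a) (G a);
  ntP : forall a b (f : hom a b), cmp (nt b) (fmap F f) = cmp (fmap G f) (nt a)
}.

Lemma nat_trans_eq (C D : category) (F G : functor C D) (s t : nat_trans F G) :
  (forall a, s a = t a) -> s = t.
Proof.
case: s t => [s sP] [t tP] /= st; have est : s = t by apply: functional_extensionality_dep.
by case: _ / est in tP *; congr NatTrans; apply: Prop_irrelevance.
Qed.

Definition nt_id (C D : category) (F : functor C D) : nat_trans F F.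
Proof. by exists (fun a => idh (F a)) => a b f; rewrite cmp1m cmpm1. Defined.

Definition nt_cmp (C D : category) (F G H : functor C D)
  (t : nat_trans G H) (s : nat_trans F G) : nat_trans F H.
Proof.
by exists (fun a => cmp (t a) (s a)) => a b f; rewrite -cmpA ntP cmpA ntP cmpA.
Defined.

Definition Func (C D : category) : category.
Proof.
refine (@Category (functor C D) (@nat_trans C D) (@nt_id C D) (@nt_cmp C D) _ _ _).
- by move=> *; apply: nat_trans_eq => a /=; apply: cmpA.
- by move=> *; apply: nat_trans_eq => a /=; apply: cmp1m.
- by move=> *; apply: nat_trans_eq => a /=; apply: cmpm1.
Defined.

Definition isomorphic (C : category) (a b : C) : Prop :=
  exists (f : hom a b) (g : hom b a), cmp g f = idh a /\ cmp f g = idh b.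

Definition equivalent (C D : category) : Prop :=
  exists (F : functor C D) (G : functor D C),
    @isomorphic (Func C C) (comp_functor G F) (id_functor C) /\
    @isomorphic (Func D D) (comp_functor F G) (id_functor D).

Section AbelianGroups.
Local Open Scope ring_scope.

Lemma additive_eq (U V : zmodType) (f g : {additive U -> V}) : f =1 g -> f = g.
Proof.
case: f g => [f [[cf]]] [g [[cg]]] /= /funext efg.
by case: _ / efg in cg *; rewrite (Prop_irrelevance cf cg).
Qed.

(** A [zmodType] also carries a choice operator; classically every abelian
    group can be given one. *)
Definition Ab : category.
Proof.
refine (@Category zmodType (fun U V => {additive U -> V})
  (fun U => idfun : {additive U -> U})
  (fun U V W g f => (g \o f : {additive U -> W})) _ _ _).
- by move=> *; apply: additive_eq.
- by move=> *; apply: additive_eq.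
- by move=> *; apply: additive_eq.
Defined.

End AbelianGroups.

(** The right action of the symmetric groups on the sets [P n], extended to
    bijections between ordinals: [bij_act op_act p h] is [p . h].  It obeys
    [(p . h) . k = p . (h \o k)]. *)
Section BijAct.

Lemma bij_card a b (h : 'I_a -> 'I_b) : bijective h -> a = b.
Proof. by move=> hb; have := bij_eq_card hb; rewrite !card_ord. Qed.

Lemma bij_perm_subproof a b (h : 'I_a -> 'I_b) (hb : bijective h) :
  injective (cast_ord (esym (bij_card hb)) \o h).
Proof. exact: inj_comp (@cast_ord_inj _ _ _) (bij_inj hb). Qed.

Definition bij_perm a b (h : 'I_a -> 'I_b) (hb : bijective h) : 'S_a :=
  perm (@bij_perm_subproof a b h hb).

Definition bij_act (P : nat -> Type) (op_act : forall n, P n -> 'S_n -> P n)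
    a b (p : P b) (h : 'I_a -> 'I_b) (hb : bijective h) : P a :=
  op_act a (eq_rect_r P p (bij_card hb)) (bij_perm hb).

End BijAct.

(** Concatenation of blocks of sizes [m 0], ..., [m (n - 1)]: the [j]-th point
    of the [i]-th block is [tagnat.Rank i j], and conversely [k] is the point
    [tagnat.sig2 k] of the block [tagnat.sig1 k]. *)
Section Blocks.
Variables (n : nat) (m : 'I_n -> nat).

Definition block_map (s : 'S_n) :
    'I_(\sum_(i < n) m (s i)) -> 'I_(\sum_(i < n) m i) :=
  fun k => tagnat.Rank (s (tagnat.sig1 k)) (tagnat.sig2 k).

Lemma Rank_inj i i' (j : 'I_(m i)) (j' : 'I_(m i')) :
  tagnat.Rank i j = tagnat.Rank i' j' -> i = i' /\ j = j' :> nat.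
Proof.
by move/(congr1 val)/eqP; rewrite tagnat.eq_Rank => /andP[/eqP e1 /eqP e2].
Qed.

Lemma sig_eq (k k' : 'I_(\sum_(i < n) m i)) :
  tagnat.sig1 k = tagnat.sig1 k' -> tagnat.sig2 k = tagnat.sig2 k' :> nat ->
  k = k'.
Proof.
move=> e1 e2; rewrite -(tagnat.sig2K k) -(tagnat.sig2K k'); apply/val_inj/eqP.
by rewrite /= tagnat.eq_Rank; apply/andP; split; apply/eqP.
Qed.

Lemma sum_perm_subproof (t : forall i, 'S_(m i)) :
  injective (fun k : 'I_(\sum_(i < n) m i) =>
    tagnat.Rank (tagnat.sig1 k) (t (tagnat.sig1 k) (tagnat.sig2 k))).
Proof.
move=> k k' /Rank_inj[e1 e2]; apply: sig_eq => //; move: e2.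
move: (tagnat.sig2 k) (tagnat.sig2 k'); rewrite e1 => j j' /val_inj.
by move/perm_inj->.
Qed.

Definition sum_perm (t : forall i, 'S_(m i)) : 'S_(\sum_(i < n) m i) :=
  perm (@sum_perm_subproof t).

End Blocks.
Arguments block_map {n} m s k.

Lemma block_map_bij n (m : 'I_n -> nat) (s : 'S_n) : bijective (block_map m s).
Proof.
apply: inj_card_bij.
  by move=> k k' /Rank_inj[/perm_inj e1 e2]; apply: sig_eq.
by rewrite !card_ord (reindex_inj (@perm_inj _ s)).
Qed.

(** Operations whose arities are only propositionally equal are compared in
    the total space [{n & op n}], by means of [Tagged].  The product of
    permutations of MathComp is in diagrammatic order,
    [(t * s)%g i = s (t i)], so [act_mul] is the axiom of a right action for
    the usual composition of permutations. *)
Record operad := Operad {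
  op :> nat -> Type;
  op_act : forall n, op n -> 'S_n -> op n;
  op_one : op 1;
  gam : forall n (m : 'I_n -> nat),
    op n -> (forall i, op (m i)) -> op (\sum_(i < n) m i);
  act_one : forall n (p : op n), op_act p 1%g = p;
  act_mul : forall n (p : op n) (s t : 'S_n), op_act (op_act p s) t = op_act p (t * s)%g;
  gam1p : forall n (p : op n),
    Tagged op (gam op_one (fun _ : 'I_1 => p)) = Tagged op p;
  gamp1 : forall n (p : op n),
    Tagged op (gam p (fun _ : 'I_n => op_one)) = Tagged op p;
  gamA : forall n (m : 'I_n -> nat) (l : forall i, 'I_(m i) -> nat)
    (p : op n) (q : forall i, op (m i)) (r : forall i j, op (l i j)),
    Tagged op (gam (gam p q) (fun k => r (tagnat.sig1 k) (tagnat.sig2 k))) =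
    Tagged op (gam p (fun i => gam (q i) (r i)));
  gam_act_outer : forall n (m : 'I_n -> nat) (p : op n)
    (q : forall i, op (m i)) (s : 'S_n),
    gam (op_act p s) (fun i => q (s i)) =
    bij_act op_act (gam p q) (block_map_bij m s);
  gam_act_inner : forall n (m : 'I_n -> nat) (p : op n)
    (q : forall i, op (m i)) (t : forall i, 'S_(m i)),
    gam p (fun i => op_act (q i) (t i)) = op_act (gam p q) (sum_perm t)
}.

Record unitary (P : operad) := Unitary {
  op_zero : P 0;
  zero_unique : forall p : P 0, p = op_zero
}.

(** In [P(n) x_(S_n) X^n] one has [(p . s, x) ~ (p, s x)], where
    [(s x)_i = x_(s^-1 i)]. *)
Record algebra (P : operad) := Algebra {
  carrier :> Type;
  mu : forall n, P n -> ('I_n -> carrier) -> carrier;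
  mu_act : forall n (p : P n) (s : 'S_n) (x : 'I_n -> carrier),
    mu (op_act p s) x = mu p (fun i => x ((s^-1)%g i));
  mu_gam : forall n (m : 'I_n -> nat) (p : P n) (q : forall i, P (m i))
    (x : forall i, 'I_(m i) -> carrier),
    mu (gam p q) (fun k => x (tagnat.sig1 k) (tagnat.sig2 k)) =
    mu p (fun i => mu (q i) (x i));
  mu_one : forall x : 'I_1 -> carrier, mu (op_one P) x = x ord0
}.

Record alg_hom (P : operad) (A B : algebra P) := AlgHom {
  alg_fun :> A -> B;
  alg_funP : forall n (p : P n) (x : 'I_n -> A),
    alg_fun (mu p x) = mu p (alg_fun \o x)
}.

Lemma alg_hom_eq (P : operad) (A B : algebra P) (f g : alg_hom A B) :
  f =1 g -> f = g.
Proof.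
case: f g => [f fP] [g gP] /= /funext efg.
by case: _ / efg in gP *; rewrite (Prop_irrelevance fP gP).
Qed.

Definition alg_id (P : operad) (A : algebra P) : alg_hom A A :=
  @AlgHom P A A id (fun _ _ _ => erefl).

Definition alg_cmp (P : operad) (A B C : algebra P)
  (g : alg_hom B C) (f : alg_hom A B) : alg_hom A C.
Proof. by exists (g \o f) => n p x /=; rewrite !alg_funP. Defined.

Definition Alg (P : operad) : category.
Proof.
refine (@Category (algebra P) (@alg_hom P) (@alg_id P) (@alg_cmp P) _ _ _).
- by move=> *; apply: alg_hom_eq.
- by move=> *; apply: alg_hom_eq.
- by move=> *; apply: alg_hom_eq.
Defined.

Section BijActTheory.
Variable P : operad.

Lemma bij_act_perm n (p : P n) (h : 'I_n -> 'I_n) (hb : bijective h) :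
  bij_act (@op_act P) p hb = op_act p (perm (bij_inj hb)).
Proof.
rewrite /bij_act (Prop_irrelevance (bij_card hb) erefl) /=; congr op_act.
by apply/permP => i; rewrite !permE /=; apply: val_inj.
Qed.

Lemma mu_bij_act (A : algebra P) a b (p : P b) (h : 'I_a -> 'I_b)
    (hb : bijective h) (x : 'I_b -> A) :
  mu (bij_act (@op_act P) p hb) (x \o h) = mu p x.
Proof.
have e := bij_card hb; case: _ / e in p h hb x *.
rewrite bij_act_perm mu_act; congr mu; apply: funext => i /=.
by congr x; rewrite -{2}(permKV (perm (bij_inj hb)) i) permE.
Qed.

Definition labelled (X : Type) := {n : nat & (P n * ('I_n -> X))%type}.

Definition label X n (p : P n) (x : 'I_n -> X) : labelled X :=
  Tagged (fun n => (P n * ('I_n -> X))%type) (p, x).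

Lemma label_eq X a b (p : P a) (q : P b) (x : 'I_a -> X) (y : 'I_b -> X) :
  Tagged P p = Tagged P q -> (forall (i : 'I_a) (j : 'I_b), i = j :> nat -> x i = y j) ->
  label p x = label q y.
Proof.
move=> epq; have e := congr1 tag epq; rewrite /= in e.
case: _ / e in q y epq *; have -> := @eq_from_Tagged nat P a p q epq.
move=> exy; congr label; apply: funext => i; exact: exy.
Qed.

End BijActTheory.

Section NestedBlocks.
Variables (n : nat) (m : 'I_n -> nat) (l : forall i, 'I_(m i) -> nat).

Local Notation L := (fun k : 'I_(\sum_(i < n) m i) =>
  @l (tagnat.sig1 k) (tagnat.sig2 k)).

Lemma sum_blocks (F : forall i, 'I_(m i) -> nat)
    (Q : forall i, pred 'I_(m i)) :
  \sum_(k < \sum_(i < n) m i | @Q _ (tagnat.sig2 k)) @F _ (tagnat.sig2 k) =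
  \sum_(i < n) \sum_(j < m i | @Q i j) @F i j.
Proof.
rewrite sig_big_dep /= (reindex (@tagnat.sig n m)) //=.
exact: onW_bij (tagnat.sig_bij).
Qed.

Lemma nested_block_val (k : 'I_(\sum_(k < \sum_(i < n) m i) L k)) :
  k = \sum_(i < n | i < tagnat.sig1 (tagnat.sig1 k)) \sum_(j < m i) @l i j +
      (\sum_(j < m (tagnat.sig1 (tagnat.sig1 k)) | j < tagnat.sig2 (tagnat.sig1 k))
         @l _ j + tagnat.sig2 k) :> nat.
Proof.
rewrite [LHS]tagnat.rect addnA; congr addn.
set k1 := tagnat.sig1 k.
have lt_k1 (k' : 'I_(\sum_(i < n) m i)) : (k' < k1) = (tagnat.sig1 k' < tagnat.sig1 k1) ||
    ((tagnat.sig1 k' == tagnat.sig1 k1) && (tagnat.sig2 k' < tagnat.sig2 k1)).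
  rewrite -[k' < k1]/(k' < k1)%O -tagnat.lt_sig Order.SigmaOrder.ltEsig !leEord -/(tagnat.sig1 k') -/(tagnat.sig1 k1).
  case: ltngtP => [lt_s|gt_s|/val_inj eq_s] /=.
  - by [].
  - by case: eqVneq => // e; rewrite e ltnn in gt_s.
  - move: eq_s; rewrite /tagnat.sig2 /tagnat.sig1; case: (tagnat.sig k') => i j.
    by case: (tagnat.sig k1) => i' j' /= e; case: _ / e in j' *; rewrite tagged_asE eqxx.
rewrite (eq_bigl _ _ lt_k1).
rewrite (@sum_blocks l (fun i j => (i < tagnat.sig1 k1) || ((i == tagnat.sig1 k1) && (j < tagnat.sig2 k1)))).
rewrite (bigID (fun i : 'I_n => i < tagnat.sig1 k1)) /=; congr addn.
  by apply: eq_bigr => i ->.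
rewrite (bigD1 (tagnat.sig1 k1)) ?ltnn //= eqxx [X in _ + X]big1 ?addn0 // => i /andP[lei /negPf nei].
by rewrite big1 // => j; rewrite (negPf lei) nei.
Qed.

Lemma Rank_label X a (p : 'I_a -> nat) (z : forall i, 'I_(p i) -> X) i (j : 'I_(p i)) :
  z (tagnat.sig1 (tagnat.Rank i j)) (tagnat.sig2 (tagnat.Rank i j)) = z i j.
Proof. by rewrite /tagnat.sig1 /tagnat.sig2 /tagnat.Rank tagnat.rankK. Qed.

Lemma nested_label X (x : forall i (j : 'I_(m i)), 'I_(l j) -> X)
    (k : 'I_(\sum_(k < \sum_(i < n) m i) L k))
    (k' : 'I_(\sum_(i < n) \sum_(j < m i) l j)) : k = k' :> nat ->
  x _ _ (tagnat.sig2 k) = x _ _ (tagnat.sig2 (tagnat.sig2 k')).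
Proof.
move=> ek; pose z i (t : 'I_(\sum_(j < m i) l j)) := x i _ (tagnat.sig2 t).
rewrite -[RHS]/(z _ (tagnat.sig2 k')).
set k1 := tagnat.sig1 k.
have -> : k' = @tagnat.Rank _ (fun i => \sum_(j < m i) l j) (tagnat.sig1 k1)
    (@tagnat.Rank _ (@l _) (tagnat.sig2 k1) (tagnat.sig2 k)).
  by apply: val_inj; rewrite -[LHS]ek [LHS]nested_block_val [RHS]tagnat.RankEsum tagnat.RankEsum.
by rewrite Rank_label /z Rank_label.
Qed.

End NestedBlocks.

Section FreeAlgebra.
Variables (P : operad) (X : Type).
Local Notation T := (labelled P X).

(** The free algebra is the quotient of the disjoint union of the sets
    [P(n) x X^n] by [(p, x) ~ (p . s, x \o s)], which is the relation
    [(p . s, y) ~ (p, s y)] for [y = x \o s]. *)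
Definition label_equiv (u v : T) : Prop :=
  exists s : 'S_(tag u),
    v = label (op_act (tagged u).1 s) (fun i => (tagged u).2 (s i)).

Lemma labelE (u : T) : u = label (tagged u).1 (tagged u).2.
Proof. by case: u => n [p x]. Qed.

Lemma label_equiv_refl u : label_equiv u u.
Proof.
exists 1%g; rewrite act_one {1}[u]labelE; congr label.
by apply: funext => i; rewrite perm1.
Qed.

Lemma label_equiv_trans v u w :
  label_equiv u v -> label_equiv v w -> label_equiv u w.
Proof.
move=> [s ->] [t ->] /=; exists (t * s)%g; rewrite act_mul; congr label.
by apply: funext => i; rewrite permM.
Qed.

Lemma label_equiv_sym u v : label_equiv u v -> label_equiv v u.
Proof.
move=> [s ->] /=; exists (s^-1)%g; rewrite /= act_mul mulVg act_one {1}[u]labelE.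
by congr label; apply: funext => i; rewrite permKV.
Qed.

Definition label_rel : rel {classic T} := fun u v => `[< label_equiv u v >].

Lemma label_rel_refl : reflexive label_rel.
Proof. by move=> u; apply/asboolP/label_equiv_refl. Qed.

Lemma label_rel_sym : symmetric label_rel.
Proof. by move=> u v; apply/asboolP/asboolP; apply: label_equiv_sym. Qed.

Lemma label_rel_trans : transitive label_rel.
Proof.
by move=> v u w /asboolP uv /asboolP vw; apply/asboolP/(label_equiv_trans uv).
Qed.

Canonical label_equivRel :=
  EquivRel label_rel label_rel_refl label_rel_sym label_rel_trans.

Definition free_carrier : Type := {eq_quot label_equivRel}%qT.

Definition fclass (u : T) : free_carrier := \pi_({eq_quot label_equivRel})%qT u.

Definition frepr (c : free_carrier) : T := repr (c : {eq_quot label_equivRel}%qT).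

Lemma freprK c : fclass (frepr c) = c.
Proof. exact: reprK. Qed.

Lemma fclass_eq u v : fclass u = fclass v <-> label_equiv u v.
Proof.
split=> [/eqquotP/asboolP //|uv].
by apply/(@eqquotP _ label_equivRel)/asboolP.
Qed.

Lemma fclass_bij_act a b (p : P b) (h : 'I_a -> 'I_b) (hb : bijective h)
    (x : 'I_b -> X) :
  fclass (label (bij_act (@op_act P) p hb) (x \o h)) = fclass (label p x).
Proof.
have e := bij_card hb; case: _ / e in p h hb x *.
rewrite bij_act_perm; apply/esym/fclass_eq; exists (perm (bij_inj hb)).
by congr label; apply: funext => i /=; rewrite permE.
Qed.

Definition label_mu n (p : P n) (u : 'I_n -> T) : T :=
  label (gam p (fun i => (tagged (u i)).1))
    (fun k => (tagged (u (tagnat.sig1 k))).2 (tagnat.sig2 k)).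

Definition free_mu n (p : P n) (c : 'I_n -> free_carrier) : free_carrier :=
  fclass (label_mu p (frepr \o c)).

Lemma free_muE n (p : P n) (u : 'I_n -> T) :
  free_mu p (fclass \o u) = fclass (label_mu p u).
Proof.
apply/esym/fclass_eq; pose v i := frepr (fclass (u i)).
have /(_ _)/cid uv i : label_equiv (u i) (v i) by apply/fclass_eq; rewrite freprK.
pose s i := projT1 (uv i).
rewrite -[frepr \o _]/v; have -> : v = fun i => label (op_act (tagged (u i)).1 (s i)) (fun j => (tagged (u i)).2 (s i j)).
  by apply: funext => i; rewrite [LHS](projT2 (uv i)).
exists (sum_perm s); rewrite /label_mu /= gam_act_inner; congr label.
apply: funext => k; rewrite permE.
by rewrite (Rank_label (fun i => (tagged (u i)).2)).
Qed.

Lemma free_mu_act n (p : P n) (s : 'S_n) (c : 'I_n -> free_carrier) :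
  free_mu (op_act p s) c = free_mu p (fun i => c ((s^-1)%g i)).
Proof.
pose u := fun i => frepr (c ((s^-1)%g i)).
have -> : c = fclass \o (fun i => u (s i)).
  by apply: funext => i /=; rewrite freprK permK.
rewrite free_muE.
have -> : (fun i => (fclass \o (fun i => u (s i))) ((s^-1)%g i)) = fclass \o u.
  by apply: funext => i /=; rewrite permKV.
rewrite free_muE /label_mu (gam_act_outer p (fun i => (tagged (u i)).1) s).
rewrite -[RHS](fclass_bij_act _ (block_map_bij _ s)); apply: (congr1 (fun x => fclass (label _ x))); apply: funext => k /=; rewrite /block_map.
by rewrite (Rank_label (fun i => (tagged (u i)).2)).
Qed.

Lemma free_mu_gam n (m : 'I_n -> nat) (p : P n) (q : forall i, P (m i))
    (c : forall i, 'I_(m i) -> free_carrier) :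
  free_mu (gam p q) (fun k => c (tagnat.sig1 k) (tagnat.sig2 k)) =
  free_mu p (fun i => free_mu (q i) (c i)).
Proof.
rewrite -[RHS]/(free_mu p (fclass \o (fun i => label_mu (q i) (frepr \o c i)))).
rewrite free_muE; congr fclass; apply: label_eq.
  exact: (gamA p q (fun i j => (tagged (frepr (c i j))).1)).
move=> k k' /(nested_label (fun i j => (tagged (frepr (c i j))).2)); exact.
Qed.

Lemma free_mu_one (c : 'I_1 -> free_carrier) : free_mu (op_one P) c = c ord0.
Proof.
have -> : c = fclass \o (fun i : 'I_1 => frepr (c ord0)).
  by apply: funext => i /=; rewrite freprK ord1.
set w := frepr (c ord0).
rewrite free_muE -[(_ \o _) ord0]/(fclass w) [in RHS](labelE w); congr fclass.
apply: label_eq => [|k j e]; first exact: gam1p.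
apply: (congr1 (tagged w).2); apply: val_inj; rewrite /= -[RHS]e.
by rewrite [RHS]tagnat.rect big_pred0 // => i; rewrite [i]ord1 [tagnat.sig1 k]ord1.
Qed.

Definition free_algebra : algebra P :=
  @Algebra P free_carrier free_mu free_mu_act free_mu_gam free_mu_one.

End FreeAlgebra.

Arguments fclass {P X} u.
Arguments frepr {P X} c.

(** The object [n] stands for the free algebra on [{1, ..., n}], and the set
    [{1, ..., n}] is encoded by ['I_n]. *)
Definition Free (P : operad) : category :=
  @full_subcategory (Alg P) nat (fun n => free_algebra P 'I_n).

(** If [x] and [y] are injective families with the same values, then
    [matching xy] sends [k] to the [l] such that [y l = x k]; [relabel] turns
    an operation with inputs labelled by [y] into one with inputs labelled
    by [x]. *)
Section Relabel.
Variables (T : eqType) (a b : nat) (x : 'I_a -> T) (y : 'I_b -> T).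

Definition same_labels : Prop :=
  [/\ injective x, injective y & codom x =i codom y].

Lemma matching_subproof (xy : same_labels) (k : 'I_a) : x k \in codom y.
Proof. by case: xy => _ _ <-; apply: codom_f. Qed.

Definition matching (xy : same_labels) (k : 'I_a) : 'I_b :=
  iinv (matching_subproof xy k).

Lemma matchingK (xy : same_labels) k : y (matching xy k) = x k.
Proof. exact: f_iinv. Qed.

Lemma matching_bij (xy : same_labels) : bijective (matching xy).
Proof.
have [xI yI exy] := xy; apply: inj_card_bij => [k k' e|].
  by apply: xI; rewrite -2!(matchingK xy) e.
rewrite -(size_codom x) -(size_codom y); apply: uniq_leq_size => [|t].
  exact/injectiveP.
by rewrite exy.
Qed.

Definition relabel (P : operad) (xy : same_labels) (p : P b) : P a :=
  bij_act (@op_act P) p (matching_bij xy).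

Lemma mu_relabel (P : operad) (A : algebra P) (xy : same_labels) (p : P b)
    (u : T -> A) :
  mu (relabel xy p) (u \o x) = mu p (u \o y).
Proof.
rewrite /relabel -[RHS](mu_bij_act p (matching_bij xy)); congr mu.
by apply: funext => k /=; rewrite matchingK.
Qed.

End Relabel.

Definition fibre n m (f : 'I_n -> 'I_m) (y : 'I_m) : {set 'I_n} :=
  [set x | f x == y].

(** [enum_val] lists a set of ordinals in increasing order. *)
Definition fibre_enum n m (f : 'I_n -> 'I_m) (y : 'I_m) :
  'I_#|fibre f y| -> 'I_n := enum_val.
Arguments fibre_enum {n m} f y k.

Lemma fibre_enumP n m (f : 'I_n -> 'I_m) y k : f (fibre_enum f y k) = y.
Proof. by have := enum_valP k; rewrite inE => /eqP. Qed.

Lemma fibre_enum_inj n m (f : 'I_n -> 'I_m) y : injective (fibre_enum f y).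
Proof. exact: enum_val_inj. Qed.

Lemma codom_fibre_enum n m (f : 'I_n -> 'I_m) y x :
  (x \in codom (fibre_enum f y)) = (f x == y).
Proof.
apply/codomP/eqP => [[k ->]|<-]; first exact: fibre_enumP.
have fx : x \in fibre f (f x) by rewrite inE.
by exists (enum_rank_in fx x); rewrite /fibre_enum enum_rankK_in.
Qed.

Record smor (P : operad) (n m : nat) := Smor {
  smap :> 'I_n -> 'I_m;
  sop : forall y, P #|fibre smap y|
}.

Lemma smor_eq (P : operad) n m (f : 'I_n -> 'I_m) (p q : forall y, P #|fibre f y|) :
  (forall y, p y = q y) -> Smor p = Smor q.
Proof. by move=> epq; congr Smor; apply: functional_extensionality_dep. Qed.

(** The ordering of [(g \o f)^-1(i)] that lists first [f^-1(j_1)], then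
    [f^-1(j_2)], and so on, where [g^-1(i) = {j_1 < j_2 < ...}]. *)
Definition block_enum n m l (g : 'I_m -> 'I_l) (f : 'I_n -> 'I_m) (i : 'I_l) :
    'I_(\sum_(k < #|fibre g i|) #|fibre f (fibre_enum g i k)|) -> 'I_n :=
  fun k => fibre_enum f _ (tagnat.sig2 k).

Lemma block_enum_labels n m l (g : 'I_m -> 'I_l) (f : 'I_n -> 'I_m) (i : 'I_l) :
  same_labels (fibre_enum (g \o f) i) (block_enum (g := g) (f := f) (i := i)).
Proof.
split; first exact: fibre_enum_inj.
- move=> k k' e; have e1 : tagnat.sig1 k = tagnat.sig1 k'.
    apply: (@fibre_enum_inj _ _ g i); rewrite -(@fibre_enumP _ _ f _ (tagnat.sig2 k)).
    by rewrite -[RHS](@fibre_enumP _ _ f _ (tagnat.sig2 k')) -!/(block_enum _) e.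
  apply: sig_eq => //; move: e; rewrite /block_enum.
  move: (tagnat.sig2 k) (tagnat.sig2 k'); rewrite e1 => j j'.
  by move/fibre_enum_inj->.
- move=> x; rewrite codom_fibre_enum; apply/eqP/codomP => [gfx|[k ->]] /=; last first.
    by rewrite !fibre_enumP.
  have /codomP[j fx] : f x \in codom (fibre_enum g i).
    by rewrite codom_fibre_enum; apply/eqP.
  have /codomP[t ->] : x \in codom (fibre_enum f (fibre_enum g i j)).
    by rewrite codom_fibre_enum fx.
  exists (tagnat.Rank j t); rewrite /block_enum.
  by rewrite (@Rank_label _ _ _ (fun j => fibre_enum f (fibre_enum g i j))).
Qed.

Definition scomp (P : operad) n m l (g : smor P m l) (f : smor P n m) : smor P n l :=
  @Smor P n l (g \o f) (fun i =>
    relabel (block_enum_labels g f i)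
      (gam (sop g i) (fun k => sop f (fibre_enum g i k)))).

Lemma card_fibre_bij n m (f : 'I_n -> 'I_m) (fb : bijective f) y :
  #|fibre f y| = 1.
Proof.
have [f' fK f'K] := fb; apply/eqP/cards1P; exists (f' y); apply/setP => x.
by rewrite !inE (can2_eq fK f'K).
Qed.

Definition op_cast (P : operad) a b (e : a = b) (p : P a) : P b :=
  eq_rect a P p b e.

Definition sbij (P : operad) n m (f : 'I_n -> 'I_m) (fb : bijective f) : smor P n m :=
  @Smor P n m f (fun y => op_cast (esym (card_fibre_bij fb y)) (op_one P)).

Lemma id_bij T : bijective (@id T).
Proof. by exists id. Qed.

Definition sid (P : operad) n : smor P n n := sbij P (@id_bij 'I_n).

Definition sact (P : operad) (A : algebra P) n m (f : smor P n m)
  (u : 'I_n -> A) : 'I_m -> A := fun y => mu (sop f y) (u \o fibre_enum f y).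

Lemma sact_comp (P : operad) (A : algebra P) n m l (g : smor P m l)
    (f : smor P n m) (u : 'I_n -> A) :
  sact (scomp g f) u = sact g (sact f u).
Proof.
apply: funext => i; rewrite /sact /= mu_relabel.
exact: (mu_gam _ _ (fun k => u \o fibre_enum f (fibre_enum g i k))).
Qed.

Lemma mu_op_cast (P : operad) (A : algebra P) a b (e : a = b) (p : P a) (u : 'I_b -> A) :
  mu (op_cast e p) u = mu p (u \o cast_ord e).
Proof.
case: _ / e u => u; congr mu; apply: funext => i /=.
by rewrite cast_ord_id.
Qed.

Lemma sact_bij (P : operad) (A : algebra P) n m (f : 'I_n -> 'I_m)
  (fb : bijective f) (u : 'I_m -> A) : sact (sbij P fb) (u \o f) = u.
Proof.
apply: funext => y; rewrite /sact /= mu_op_cast mu_one /=.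
by rewrite fibre_enumP.
Qed.

Lemma free_label_inj (P : operad) X n (p q : P n) (x : 'I_n -> X) :
  injective x -> fclass (label p x) = fclass (label q x) -> p = q.
Proof.
move=> xI /fclass_eq[s /= e].
have [-> ex] := @eq_from_Tagged nat (fun n => P n * ('I_n -> X))%type n _ _ e.
suff -> : s = 1%g by rewrite act_one.
apply/permP => i; rewrite perm1; apply: xI.
by have := congr1 (fun z => z i) ex.
Qed.

Definition free_gen (P : operad) X (x : X) : free_algebra P X :=
  fclass (label (op_one P) (fun=> x)).

Arguments free_gen P {X} x.

Lemma mu_gens (P : operad) X n (p : P n) (x : 'I_n -> X) :
  mu p (free_gen P \o x : 'I_n -> free_algebra P X) = fclass (label p x).
Proof.
rewrite -[LHS]/(free_mu p (fclass \o (fun i => label (op_one P) (fun=> x i)))).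
rewrite free_muE; congr fclass; apply: label_eq; first exact: gamp1.
move=> k j e; congr x; apply: val_inj; rewrite /= -[RHS]e [RHS]tagnat.rect.
rewrite [tagnat.sig2 k]ord1 addn0 -(big_ord_widen _ (fun=> 1)) ?sum1_card ?card_ord //.
exact/ltnW/ltn_ord.
Qed.

Lemma sact_inj (P : operad) n m (f g : smor P n m) :
  smap f = smap g -> sact f (@free_gen P 'I_n) = sact g (@free_gen P 'I_n) -> f = g.
Proof.
case: f g => [f p] [g q] /= efg; case: _ / efg in q * => epq.
apply: smor_eq => y; have := congr1 (fun z => z y) epq.
rewrite /sact !mu_gens; apply: free_label_inj; exact: fibre_enum_inj.
Qed.

Lemma scompA (P : operad) a b c d (h : smor P c d) (g : smor P b c)
  (f : smor P a b) : scomp h (scomp g f) = scomp (scomp h g) f.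
Proof. by apply: sact_inj => //; rewrite !sact_comp. Qed.

Lemma scomp1m (P : operad) a b (f : smor P a b) : scomp (sid P b) f = f.
Proof. by apply: sact_inj => //; rewrite sact_comp; apply: (@sact_bij _ _ _ _ id). Qed.

Lemma scompm1 (P : operad) a b (f : smor P a b) : scomp f (sid P a) = f.
Proof.
apply: sact_inj => //; rewrite sact_comp; congr sact.
exact: (@sact_bij _ _ _ _ id).
Qed.

Definition Sop (P : operad) : category :=
  Category (@scompA P) (@scomp1m P) (@scompm1 P).

Definition surjb n m (f : 'I_n -> 'I_m) : bool := [forall y, y \in codom f].

Lemma surjP n m (f : 'I_n -> 'I_m) : reflect (forall y, exists x, f x = y) (surjb f).
Proof.
apply: (iffP forallP) => fs y; first by have /codomP[x ->] := fs y; exists x.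
by have [x <-] := fs y; apply: codom_f.
Qed.

Lemma surj_comp n m l (g : 'I_m -> 'I_l) (f : 'I_n -> 'I_m) :
  surjb g -> surjb f -> surjb (g \o f).
Proof.
move=> /surjP gs /surjP fs; apply/surjP => z.
by have [y <-] := gs z; have [x <-] := fs y; exists x.
Qed.

Lemma surj_bij n m (f : 'I_n -> 'I_m) : bijective f -> surjb f.
Proof. by move=> [f' _ f'K]; apply/surjP => y; exists (f' y); rewrite f'K. Qed.

Definition omor (n m : nat) := {f : 'I_n -> 'I_m | surjb f}.

Definition omap n m (f : omor n m) : 'I_n -> 'I_m := val f.

Definition oid n : omor n n := Sub id (surj_bij (@id_bij 'I_n)).

Definition ocomp n m l (g : omor m l) (f : omor n m) : omor n l :=
  Sub (omap g \o omap f) (surj_comp (valP g) (valP f)).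

Definition Omega : category.
Proof.
refine (@Category nat omor oid ocomp _ _ _).
- by move=> *; apply: val_inj.
- by move=> *; apply: val_inj.
- by move=> *; apply: val_inj.
Defined.

Definition opmor (P : operad) (n m : nat) := {f : smor P n m | surjb f}.

Definition opmap P n m (f : opmor P n m) : smor P n m := val f.

Definition opid P n : opmor P n n := Sub (sid P n) (surj_bij (@id_bij 'I_n)).

Definition opcomp P n m l (g : opmor P m l) (f : opmor P n m) : opmor P n l :=
  Sub (scomp (opmap g) (opmap f)) (surj_comp (valP g) (valP f)).

Definition OmegaP (P : operad) : category.
Proof.
refine (@Category nat (opmor P) (opid P) (@opcomp P) _ _ _).
- by move=> *; apply: val_inj; apply: scompA.
- by move=> *; apply: val_inj; apply: scomp1m.
- by move=> *; apply: val_inj; apply: scompm1.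
Defined.

Record is_pullback A B C D (f : 'I_A -> 'I_B) (g : 'I_C -> 'I_D)
    (phi : 'I_A -> 'I_C) (psi : 'I_B -> 'I_D) : Prop := IsPullback {
  pb_comm : forall a, psi (f a) = g (phi a);
  pb_univ : forall b c, psi b = g c -> exists! a, f a = b /\ phi a = c
}.

Section Transport.
Variables (A B C D : nat) (f : 'I_A -> 'I_B) (g : 'I_C -> 'I_D).
Variables (phi : 'I_A -> 'I_C) (psi : 'I_B -> 'I_D).

Lemma pullback_labels (pb : is_pullback f g phi psi) (c : 'I_C) :
  same_labels (fibre_enum psi (g c)) (f \o fibre_enum phi c).
Proof.
split; first exact: fibre_enum_inj.
- move=> k k' /= e; apply: (@fibre_enum_inj _ _ phi c).
  have [|a [_ aU]] := pb_univ pb (b := f (fibre_enum phi c k)) (c := c).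
    by rewrite (pb_comm pb) fibre_enumP.
  by rewrite -(aU (fibre_enum phi c k)) ?fibre_enumP // -(aU (fibre_enum phi c k')) ?fibre_enumP.
- move=> b; rewrite codom_fibre_enum; apply/eqP/codomP => [pbc|[k ->]] /=; last first.
    by rewrite (pb_comm pb) fibre_enumP.
  have [a [[fa pa] _]] := pb_univ pb pbc.
  have /codomP[k ek] : a \in codom (fibre_enum phi c).
    by rewrite codom_fibre_enum pa.
  by exists k; rewrite -fa ek.
Qed.

(** The map [g_*] from [P(|phi^-1(c)|)] to [P(|psi^-1(g(c))|)], namely
    [g_*(w) = w . h^-1], where [h] is the bijection induced by [f] between
    the fibres (the matching used here is [h^-1]). *)
Definition transport (P : operad) (pb : is_pullback f g phi psi) (c : 'I_C)
    (w : P #|fibre phi c|) : P #|fibre psi (g c)| :=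
  relabel (pullback_labels pb c) w.

End Transport.

Definition is_square (P : operad) A B C D (f : omor A B) (g : omor C D)
    (phi : opmor P A C) (psi : opmor P B D) : Prop :=
  exists pb : is_pullback (omap f) (omap g) (opmap phi) (opmap psi),
  forall c, transport pb (sop (opmap phi) c) = sop (opmap psi) (omap g c).

Lemma perm_bij n (s : 'S_n) : bijective s.
Proof. exact: Bijective (permK s) (permKV s). Qed.

Definition operm n (s : 'S_n) : omor n n := Sub (s : 'I_n -> 'I_n) (surj_bij (perm_bij s)).

Definition opperm P n (s : 'S_n) : opmor P n n :=
  Sub (sbij P (perm_bij s)) (surj_bij (perm_bij s)).

Section Inclusion.
Variables (P : operad) (unP : unitary P) (n : nat) (A' : {set 'I_n}).

(** The inclusion of [A'], identified with ['I_#|A'|] by the increasing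
    bijection. *)
Definition incl : 'I_#|A'| -> 'I_n := enum_val.

Lemma card_fibre_incl y : #|fibre incl y| = (y \in A').
Proof.
case: (boolP (y \in A')) => yA'.
  apply/eqP/cards1P; exists (enum_rank_in yA' y); apply/setP => x.
  by rewrite !inE; apply/eqP/eqP => [e|->]; rewrite /incl ?enum_rankK_in //; apply/enum_val_inj; rewrite enum_rankK_in.
apply/eqP; rewrite cards_eq0; apply/eqP/setP => x; rewrite !inE.
by apply: contraNF yA' => /eqP <-; apply: enum_valP.
Qed.

Definition unit_or_zero (b : bool) : P b :=
  if b return P b then op_one P else op_zero unP.

Definition sincl : smor P #|A'| n :=
  @Smor P _ _ incl (fun y =>
    op_cast (esym (card_fibre_incl y)) (unit_or_zero (y \in A'))).

End Inclusion.

Section Admissible.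
Variables (P : operad) (unP : unitary P) (A B C : nat).
Variables (f : omor A B) (phi : opmor P A C).

Definition admissible (A' : {set 'I_A}) : bool :=
  surjb (omap f \o incl (A' := A')) && surjb (opmap phi \o incl (A' := A')).

Definition Adm := {A' : {set 'I_A} | admissible A'}.

Definition omor_restr (A' : Adm) : omor #|val A'| B :=
  Sub (omap f \o incl (A' := val A')) (proj1 (andP (valP A'))).

Definition opmor_restr (A' : Adm) : opmor P #|val A'| C :=
  Sub (scomp (opmap phi) (sincl unP (val A'))) (proj2 (andP (valP A'))).

End Admissible.

Section PseudoMackey.
Local Open Scope ring_scope.
Variables (P : operad) (unP : unitary P).

Record janus := Janus {
  jobj :> nat -> zmodType;
  push : forall a b, omor a b -> {additive jobj a -> jobj b};
  pull : forall a b, opmor P a b -> {additive jobj b -> jobj a};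
  push_functor : @is_functor Omega Ab jobj push;
  pull_functor :
    @is_functor (opposite (OmegaP P)) Ab jobj (fun a b u => pull u)
}.

Definition pseudo_mackey (M : janus) : Prop :=
  (forall n (s : 'S_n) (x : M n), push M (operm s) (pull M (opperm P s) x) = x) /\
  (forall A B C D (f : omor A B) (g : omor C D)
     (phi : opmor P A C) (psi : opmor P B D),
   is_square f g phi psi ->
   forall x : M C,
     pull M psi (push M g x) =
     \sum_(A' : Adm f phi)
        push M (omor_restr A') (pull M (opmor_restr unP A') x)).

Record pmackey := PMackey {
  pjanus :> janus;
  pmackeyP : pseudo_mackey pjanus
}.

Record pm_hom (M N : pmackey) := PMHom {
  pm_fun :> forall n, {additive M n -> N n};
  pm_push : forall a b (f : omor a b) (x : M a),
    pm_fun b (push M f x) = push N f (pm_fun a x);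
  pm_pull : forall a b (f : opmor P a b) (x : M b),
    pm_fun a (pull M f x) = pull N f (pm_fun b x)
}.

Lemma pm_hom_eq (M N : pmackey) (s t : pm_hom M N) :
  (forall n x, s n x = t n x) -> s = t.
Proof.
case: s t => [s s1 s2] [t t1 t2] /= st.
have est : s = t.
  by apply: functional_extensionality_dep => n; apply: additive_eq => x; apply: st.
by case: _ / est in t1 t2 *; rewrite (Prop_irrelevance s1 t1) (Prop_irrelevance s2 t2).
Qed.

Definition pm_id (M : pmackey) : pm_hom M M.
Proof. by exists (fun n => idfun). Defined.

Definition pm_cmp (M N L : pmackey) (t : pm_hom N L) (s : pm_hom M N) : pm_hom M L.
Proof.
exists (fun n => t n \o s n) => a b f x /=.
  by rewrite !pm_push.
by rewrite !pm_pull.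
Defined.

Definition PMack : category.
Proof.
refine (@Category pmackey pm_hom pm_id pm_cmp _ _ _).
- by move=> *; apply: pm_hom_eq.
- by move=> *; apply: pm_hom_eq.
- by move=> *; apply: pm_hom_eq.
Defined.

End PseudoMackey.

(* Main.v *)
From HB Require Import structures.
From mathcomp Require Import all_boot all_order all_algebra all_fingroup.
From mathcomp Require Import generic_quotient boolp.
Require Import Defs.

Set Implicit Arguments.
Unset Strict Implicit.
Unset Printing Implicit Defensive.

Import GRing.Theory.

(** Write [F(n)] for the free algebra on ['I_n]. A map [f : n -> m] induces
    [fpush f : F(n) -> F(m)], and a morphism [u : n -> m] of [S(P)] induces
    [fpull u : F(m) -> F(n)], sending a generator [y] to the word given by the
    operation that [u] carries at [y]. A word in [F(m)] is an operation whose
    inputs are labelled by [m], so every homomorphism is a span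
    [fpush g \o fpull u] ([span_exists]), unique up to a bijection of the apex
    ([span_unique]), and spans compose by pullback ([sq_exists]). A functor on
    [Free(P)] is therefore a pair of functors, covariant in all maps and
    contravariant in all of [S(P)], with the base change
    [psi^* g_* = f_* phi^*] for pullback squares. The theorem removes the
    non-surjective maps from this description; it is the passage to cross
    effects, in the style of the Dold-Kan correspondence.

    Killing the generators outside [B] by means of the constant [0_P] is an
    endomorphism [rho B] of [F(n)], and [rho A \o rho B = rho (A :&: B)]. For a
    functor [T], these commuting idempotents decompose [T(n)] as the direct
    sum, over the subsets [K] of [n], of the cross effects
    [cr T (#|K|)], where [cr T (n)] is the common kernel of the [T(rho B)] for
    [B] proper ([cr_decomposition], by Moebius inversion over subsets).
    Surjections act on cross effects, covariantly by restricting [T(fpush f)]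
    and contravariantly by projecting [T(fpull u)] back to the cross effect.
    The Mackey formula is base change in [T] with the decomposition of the
    apex [T(A)] inserted in the middle: the terms of subsets that are
    not admissible vanish ([cr_pseudo_mackey]).

    Conversely a pseudo-Mackey functor [M] is assembled into
    [n |-> \prod_(K : {set 'I_n}) M #|K|], where maps act by restriction to
    subsets. Its base change is the Mackey formula applied to the square
    restricted to each pair of subsets: the subsets of the pullback with the
    prescribed images correspond to the admissible subsets of the restricted
    square ([mackey_restr], [tpull_tpush]).

    The counit [eps] is the decomposition of [T(n)] itself. The unit [eta]
    reads off the component at the full subset, which is an isomorphism since
    the cross effect of an assembled functor consists of the families
    concentrated there ([cr_assemblyP]). *)

(** * Isomorphisms of functors *)

Lemma nat_iso_isomorphic (C D : category) (F G : functor C D) (t : nat_trans F G)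
    (s : forall a, hom (G a) (F a)) :
  (forall a, cmp (s a) (t a) = idh (F a)) ->
  (forall a, cmp (t a) (s a) = idh (G a)) ->
  @isomorphic (Func C D) F G.
Proof.
move=> st ts.
have sP a b (f : hom a b) : cmp (s b) (fmap G f) = cmp (fmap F f) (s a).
  by rewrite -[fmap G f]cmpm1 -ts [cmp (fmap G f) _]cmpA -ntP -cmpA cmpA st cmp1m.
by exists t, (NatTrans sP); split; apply: nat_trans_eq.
Qed.

Lemma nat_isoP (C D : category) (F G : functor C D) (t : nat_trans F G) :
  (forall a, exists s : hom (G a) (F a),
     cmp s (t a) = idh (F a) /\ cmp (t a) s = idh (G a)) ->
  @isomorphic (Func C D) F G.
Proof.
move=> /(_ _)/cid ex; apply: (@nat_iso_isomorphic _ _ _ _ t (fun a => projT1 (ex a))) => a.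
  by have [] := projT2 (ex a).
by have [] := projT2 (ex a).
Qed.

Section AdditiveIsomorphisms.
Local Open Scope ring_scope.

(** An inverse map that is merely chosen pointwise is additive by injectivity,
    so isomorphisms below need only be checked on elements. *)
Lemma additive_inverse (U V : zmodType) (f : {additive U -> V}) :
  injective f -> (forall y, exists x, f x = y) ->
  exists g : {additive V -> U}, cancel f g /\ cancel g f.
Proof.
move=> fI /(_ _)/cid fS; pose g y := projT1 (fS y).
have gK : cancel g f by move=> y; exact: projT2 (fS y).
have gA : {morph g : x y / x - y} by move=> x y; apply: fI; rewrite raddfB !gK.
pose ga := GRing.isZmodMorphism.Build V U g gA.
pose G : {additive V -> U} := HB.pack g ga.
by exists G; split=> [x|//]; apply: fI; rewrite gK.
Qed.

Lemma func_ab_iso (C : category) (F G : functor C Ab) (t : nat_trans F G) :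
  (forall a, injective (t a)) -> (forall a y, exists x, t a x = y) ->
  exists s : nat_trans G F,
    nt_cmp s t = nt_id F /\ nt_cmp t s = nt_id G.
Proof.
move=> tI tS; have /(_ _)/cid inv a := additive_inverse (tI a) (tS a).
pose s a := projT1 (inv a).
have st a : cancel (t a) (s a) by have [] := projT2 (inv a).
have ts a : cancel (s a) (t a) by have [] := projT2 (inv a).
have sP a b (f : hom a b) : @cmp Ab _ _ _ (s b) (fmap G f) = @cmp Ab _ _ _ (fmap F f) (s a).
  apply: additive_eq => y; apply: tI => /=; rewrite ts.
  have e := congr1 (fun h : {additive F a -> G b} => h (s a y)) (ntP t f).
  by rewrite [RHS]e /= ts.
exists (@NatTrans C Ab G F s sP); split; apply: nat_trans_eq => a; apply: additive_eq => x.
  exact: st.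
exact: ts.
Qed.

Lemma pmack_iso (P : operad) (unP : unitary P) (M N : pmackey unP) (t : pm_hom M N) :
  (forall n, injective (t n)) -> (forall n y, exists x, t n x = y) ->
  exists s : pm_hom N M, pm_cmp s t = pm_id M /\ pm_cmp t s = pm_id N.
Proof.
move=> tI tS; have /(_ _)/cid inv n := additive_inverse (tI n) (tS n).
pose s n := projT1 (inv n).
have st n : cancel (t n) (s n) by have [] := projT2 (inv n).
have ts n : cancel (s n) (t n) by have [] := projT2 (inv n).
have s_push a b (f : omor a b) x : s b (push N f x) = push M f (s a x).
  by apply: tI; rewrite ts pm_push ts.
have s_pull a b (u : opmor P a b) x : s a (pull N u x) = pull M u (s b x).
  by apply: tI; rewrite ts pm_pull ts.
exists (PMHom s_push s_pull); split; apply: pm_hom_eq => n x; [exact: st | exact: ts].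
Qed.

End AdditiveIsomorphisms.

(** * The maps of free algebras given by maps and by operations *)

Arguments free_gen P {X} x.
Arguments mu : simpl never.

Section FreeMaps.
Variable P : operad.
Local Notation "'Fr' X" := (free_algebra P X) (at level 10, X at level 8).

(** Every element of a free algebra is an operation applied to generators. *)
Lemma free_hom_ext X (A : algebra P) (f g : alg_hom (Fr X) A) :
  (forall x, f (free_gen P x) = g (free_gen P x)) -> f = g.
Proof.
move=> fg; apply: alg_hom_eq => c; rewrite -[c]freprK [frepr c]labelE -mu_gens.
by rewrite !alg_funP; congr mu; apply: funext => i /=.
Qed.

Section Lift.
Variables (X : Type) (A : algebra P) (u : X -> A).

(** The value is computed on a chosen representative word; [lift_funE] says
    that the choice does not matter, because a structure map of an algebra is
    invariant under permuting the inputs. *)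
Definition lift_fun (c : Fr X) : A :=
  mu (tagged (frepr c)).1 (u \o (tagged (frepr c)).2).

Lemma lift_funE n (p : P n) (x : 'I_n -> X) :
  lift_fun (fclass (label p x)) = mu p (u \o x).
Proof.
rewrite /lift_fun; set c := fclass _.
have /fclass_eq[s ->] : fclass (label p x) = fclass (frepr c) by rewrite freprK.
rewrite /= mu_act; congr mu; apply: funext => i /=.
by rewrite permKV.
Qed.

Lemma lift_funP n (p : P n) (c : 'I_n -> Fr X) :
  lift_fun (mu p c) = mu p (lift_fun \o c).
Proof.
have -> : c = fclass \o (frepr \o c) by apply: funext => i /=; rewrite freprK.
rewrite -[mu p _]/(free_mu p _) free_muE lift_funE.
rewrite (mu_gam _ _ (fun i => u \o (tagged (frepr (c i))).2)); congr mu.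
by apply: funext => i /=; rewrite freprK.
Qed.

Definition lift : alg_hom (Fr X) A := AlgHom lift_funP.

Lemma lift_gen x : lift (free_gen P x) = u x.
Proof. by rewrite /= lift_funE mu_one. Qed.

End Lift.

Definition fpush X Y (f : X -> Y) : alg_hom (Fr X) (Fr Y) :=
  lift (fun x => free_gen P (f x) : Fr Y).

Definition fpull n m (u : smor P n m) : alg_hom (Fr 'I_m) (Fr 'I_n) :=
  lift (sact u (free_gen P : _ -> Fr 'I_n)).

Arguments fpush : simpl never.
Arguments fpull : simpl never.

Lemma alg_hom_congr (A B : algebra P) (f g : alg_hom A B) x : f = g -> f x = g x.
Proof. by move->. Qed.

Lemma alg_cmpE (A B C : algebra P) (g : alg_hom B C) (f : alg_hom A B) x :
  alg_cmp g f x = g (f x).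
Proof. by []. Qed.

Lemma fpush_gen X Y (f : X -> Y) x : fpush f (free_gen P x) = free_gen P (f x).
Proof. exact: lift_gen. Qed.

Lemma fpull_gen n m (u : smor P n m) y :
  fpull u (free_gen P y) = mu (sop u y) (free_gen P \o fibre_enum u y : _ -> Fr 'I_n).
Proof. exact: lift_gen. Qed.

Lemma alg_sact (A B : algebra P) (f : alg_hom A B) n m (u : smor P n m) (x : 'I_n -> A) :
  f \o sact u x = sact u (f \o x).
Proof. by apply: funext => y; rewrite /sact /= alg_funP. Qed.

Lemma fpush_id X : fpush id = alg_id (Fr X).
Proof. by apply: free_hom_ext => x; rewrite fpush_gen. Qed.

Lemma fpush_comp X Y Z (g : Y -> Z) (f : X -> Y) :
  fpush (g \o f) = alg_cmp (fpush g) (fpush f).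
Proof. by apply: free_hom_ext => x; rewrite alg_cmpE !fpush_gen. Qed.

Lemma fpull_id n : fpull (sid P n) = alg_id (Fr 'I_n).
Proof.
apply: free_hom_ext => x; rewrite lift_gen /=.
exact: (congr1 (fun z => z x) (@sact_bij P (Fr 'I_n) _ _ id (@id_bij _) (free_gen P))).
Qed.

Lemma fpull_comp n m l (v : smor P m l) (u : smor P n m) :
  fpull (scomp v u) = alg_cmp (fpull u) (fpull v).
Proof.
apply: free_hom_ext => y; rewrite lift_gen sact_comp.
transitivity (fpull u (sact v (free_gen P : _ -> Fr 'I_m) y)).
  rewrite -[RHS]/((fpull u \o sact v _) y) alg_sact; congr (sact v _ y).
  by apply: funext => i; exact/esym/(lift_gen (sact u _)).
by rewrite alg_cmpE lift_gen.
Qed.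

(** Comparing morphisms of [S(P)] through the homomorphisms that they induce
    turns identities between permuted and cast operations into equalities of
    words, which are computed by [mu]. *)
Lemma smor_ext n m (u v : smor P n m) : smap u =1 smap v -> fpull u = fpull v -> u = v.
Proof.
move=> /funext uv e; apply: sact_inj => //; apply: funext => y.
by have := congr1 (fun z : alg_hom _ _ => z (free_gen P y)) e; rewrite !lift_gen.
Qed.

End FreeMaps.

(** * Spans *)

Section Spans.
Variable P : operad.
Local Notation "'Fr' X" := (free_algebra P X) (at level 10, X at level 8).

(** Squares with horizontal maps that need not be surjective. The base change
    condition on words is the form of the transport condition that can be
    composed and restricted. *)
Record sq A B C D (f : 'I_A -> 'I_B) (g : 'I_C -> 'I_D)
    (phi : smor P A C) (psi : smor P B D) : Prop := Sq {
  sq_pb : is_pullback f g phi psi;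
  sq_base : alg_cmp (fpush P f) (fpull phi) = alg_cmp (fpull psi) (fpush P g)
}.

Lemma fpush_fpull_gen n m X (g : 'I_n -> X) (u : smor P n m) y :
  fpush P g (fpull u (free_gen P y)) =
  mu (sop u y) (free_gen P \o (g \o fibre_enum u y) : _ -> Fr X).
Proof.
rewrite fpull_gen alg_funP; congr mu; apply: funext => i; exact: fpush_gen.
Qed.

(** At a generator [c] the two sides of base change are the word of [c]
    relabelled along [f] and the word of [g c]. The labels of the latter are
    distinct, so equality of the words is equality of the operations. *)
Lemma is_squareP A B C D (f : omor A B) (g : omor C D)
    (phi : opmor P A C) (psi : opmor P B D) :
  is_square f g phi psi <-> sq (omap f) (omap g) (opmap phi) (opmap psi).
Proof.
have transportE (pb : is_pullback (omap f) (omap g) (opmap phi) (opmap psi)) c :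
    mu (transport pb (sop (opmap phi) c))
      (free_gen P \o fibre_enum (opmap psi) (omap g c) : _ -> Fr 'I_B) =
    mu (sop (opmap phi) c) (free_gen P \o (omap f \o fibre_enum (opmap phi) c) : _ -> Fr 'I_B).
  exact: mu_relabel.
split=> [[pb tr]|[pb base]]; [split=> // | exists pb => c].
  apply: free_hom_ext => c; rewrite !alg_cmpE fpush_gen fpush_fpull_gen fpull_gen -tr.
  exact/esym/transportE.
have := alg_hom_congr (free_gen P c) base.
rewrite !alg_cmpE fpush_gen fpush_fpull_gen -transportE fpull_gen !mu_gens.
exact/free_label_inj/fibre_enum_inj.
Qed.

Lemma same_labels_sym (T : eqType) a b (x : 'I_a -> T) (y : 'I_b -> T) :
  same_labels x y -> same_labels y x.
Proof. by case=> xI yI xy; split=> // t; rewrite xy. Qed.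

Lemma sq_exists B C D (g : 'I_C -> 'I_D) (psi : smor P B D) :
  exists A (f : 'I_A -> 'I_B) (phi : smor P A C), sq f g phi psi.
Proof.
pose S := [set x : 'I_B * 'I_C | psi x.1 == g x.2].
pose f (a : 'I_#|S|) := (enum_val a).1; pose h (a : 'I_#|S|) := (enum_val a).2.
have pb : is_pullback f g h psi.
  split=> [a|b c e]; first by have := enum_valP a; rewrite inE => /eqP.
  have Sbc : (b, c) \in S by rewrite inE e.
  have eK := enum_rankK_in Sbc Sbc.
  exists (enum_rank_in Sbc (b, c)); split=> [|a [fa ha]]; first by rewrite /f /h eK.
  by apply: enum_val_inj; rewrite eK -fa -ha -surjective_pairing.
pose phi : smor P #|S| C :=
  @Smor P _ _ h (fun c => relabel (same_labels_sym (pullback_labels pb c)) (sop psi (g c))).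
exists #|S|, f, phi; split=> //; apply: free_hom_ext => c.
rewrite !alg_cmpE fpush_gen fpush_fpull_gen fpull_gen.
exact: (mu_relabel (same_labels_sym (pullback_labels pb c))).
Qed.

(** The apex is the disjoint union of the inputs of the words that represent
    the images of the generators; [g] records their labels. *)
Lemma span_exists n m (al : alg_hom (Fr 'I_n) (Fr 'I_m)) :
  exists k (g : 'I_k -> 'I_m) (u : smor P k n), al = alg_cmp (fpush P g) (fpull u).
Proof.
pose w i := frepr (al (free_gen P i)); pose s i := tag (w i).
pose h : 'I_(\sum_(i < n) s i) -> 'I_n := tagnat.sig1.
pose g (k : 'I_(\sum_(i < n) s i)) : 'I_m := (tagged (w (h k))).2 (tagnat.sig2 k).
have lab i : same_labels (fibre_enum h i) (@tagnat.Rank n s i).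
  split=> [|j j' /Rank_inj[_ /val_inj]//|k]; first exact: fibre_enum_inj.
  rewrite codom_fibre_enum; apply/eqP/codomP => [<-|[j ->]].
    by exists (tagnat.sig2 k); rewrite tagnat.sig2K.
  exact: tagnat.Rank1K.
exists _, g, (@Smor P _ _ h (fun i => relabel (lab i) (tagged (w i)).1)).
apply: free_hom_ext => i; rewrite alg_cmpE fpush_fpull_gen.
rewrite [RHS](@mu_relabel _ _ _ _ _ _ (Fr 'I_m) (lab i) _ (free_gen P \o g)).
rewrite -[LHS]freprK -/(w i) [X in fclass X]labelE -mu_gens; congr mu; apply: funext => j /=.
by congr free_gen; rewrite /g /h (@Rank_label _ _ s (fun i => (tagged (w i)).2)).
Qed.

(** Two words that represent the same element differ by a permutation of their
    inputs; these permutations glue, fibre by fibre, to a bijection of the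
    apices. It is stated as a square over the identity so that independence of
    the span becomes an instance of base change. *)
Lemma span_unique n m k k' (g : 'I_k -> 'I_m) (u : smor P k n)
    (g' : 'I_k' -> 'I_m) (u' : smor P k' n) :
  alg_cmp (fpush P g) (fpull u) = alg_cmp (fpush P g') (fpull u') ->
  exists t : 'I_k' -> 'I_k, g \o t = g' /\ sq t id u' u.
Proof.
move=> e.
have /(_ _)/cid loc i : exists t : 'I_#|fibre u' i| -> 'I_#|fibre u i|,
    [/\ bijective t, g \o (fibre_enum u i \o t) = g' \o fibre_enum u' i &
        mu (sop u' i) (free_gen P \o (fibre_enum u i \o t) : _ -> Fr 'I_k) =
        mu (sop u i) (free_gen P \o fibre_enum u i : _ -> Fr 'I_k)].
  have := alg_hom_congr (free_gen P i) e.
  rewrite !alg_cmpE !fpush_fpull_gen !mu_gens => /fclass_eq[s].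
  move: (sop u i) (sop u' i) (fibre_enum u i) (fibre_enum u' i) s => /=.
  move: #|fibre u' i| => b p q x y s ls.
  have eb := congr1 tag ls; rewrite /= in eb; case: _ / eb in p x s ls *.
  have [-> ->] := @eq_from_Tagged nat (fun n => P n * ('I_n -> 'I_m))%type _ _ _ ls.
  exists s; split=> //; first exact: perm_bij.
  rewrite [LHS]mu_act -mu_gens; apply: (congr1 (@mu P (Fr 'I_k) _ p)); apply: funext => j /=.
  by rewrite permKV.
(* [t] acts on the fibre over [i] as the local bijection [t0 i]. *)
pose t0 i := projT1 (loc i).
have /(_ _)/cid idx x : exists j : 'I_#|fibre u' (u' x)|, fibre_enum u' (u' x) j = x.
  have /codomP[j xj] : x \in codom (fibre_enum u' (u' x)) by rewrite codom_fibre_enum.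
  by exists j; rewrite -xj.
pose t x := fibre_enum u _ (t0 (u' x) (projT1 (idx x))).
have tE i j : t (fibre_enum u' i j) = fibre_enum u i (t0 i j).
  rewrite /t; case: (idx _) => j' /=; move: (fibre_enumP j) j' => -> j'.
  by move/fibre_enum_inj->.
have tP i : t \o fibre_enum u' i = fibre_enum u i \o t0 i by apply: funext => j /=.
exists t; split.
  apply: funext => x /=; have [j <-] := idx x; rewrite tE.
  have [_ + _] := projT2 (loc (u' x)) => /(congr1 (fun z => z j)) /= <-.
  by [].
split; first split.
- by move=> a; rewrite /t fibre_enumP.
- move=> b c /= ebc.
  have /codomP[j ej] : b \in codom (fibre_enum u c) by rewrite codom_fibre_enum ebc.
  have [[r t0K rK] _ _] := projT2 (loc c); exists (fibre_enum u' c (r j)); split.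
    by rewrite tE fibre_enumP ej -[t0 c _]/(projT1 (loc c) _) rK.
  move=> a [ta ua]; have [j' ej'] : exists j', fibre_enum u' c j' = a.
    by rewrite -ua; case: (idx a) => j' ?; exists j'.
  rewrite -ej' in ta *; congr fibre_enum; move: ta; rewrite tE ej => /fibre_enum_inj <-.
  by rewrite t0K.
apply: free_hom_ext => i; rewrite !alg_cmpE fpush_id fpush_fpull_gen tP fpull_gen.
by have [_ _ ->] := projT2 (loc i).
Qed.

End Spans.

(** * Restriction to subsets *)

Section Restriction.
Variables (P : operad) (unP : unitary P).
Local Notation "'Fr' X" := (free_algebra P X) (at level 10, X at level 8).

Definition azero (A : algebra P) : A :=
  mu (op_zero unP) (fun i : 'I_0 => False_rect A (notF (ltn_ord i))).

Lemma mu_nullary (A : algebra P) n (p : P n) (x : 'I_n -> A) :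
  n = 0 -> mu p x = azero A.
Proof.
move=> e; rewrite e in p x *; rewrite [p](zero_unique unP).
by congr mu; apply: funext => -[].
Qed.

(** The composite of any operation with constants is an operation without
    inputs, and there is only one. *)
Lemma mu_azero (A : algebra P) n (p : P n) : mu p (fun=> azero A) = azero A.
Proof.
rewrite -[LHS](@mu_gam P A n (fun=> 0) p (fun=> op_zero unP)).
by apply: mu_nullary; rewrite big1.
Qed.

Lemma alg_azero (A B : algebra P) (f : alg_hom A B) : f (azero A) = azero B.
Proof. by rewrite alg_funP; apply: mu_nullary. Qed.

Lemma fpull_out n m (u : smor P n m) y :
  (forall x, u x != y) -> fpull u (free_gen P y) = azero (Fr 'I_n).
Proof.
move=> uy; rewrite fpull_gen; apply: mu_nullary; apply: eq_card0 => x.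
by rewrite inE (negPf (uy x)).
Qed.

(** Morphisms such as inclusions and bijections, whose operations are all
    units or constants: each is determined by its underlying map. *)
Definition inj_smor n m (u : smor P n m) : Prop :=
  injective u /\ forall x, fpull u (free_gen P (u x)) = free_gen P x.

Lemma inj_smor_eq n m (u v : smor P n m) :
  inj_smor u -> inj_smor v -> smap u =1 smap v -> u = v.
Proof.
move=> [_ uK] [_ vK] uv; apply: smor_ext => //; apply: free_hom_ext => y.
have [[x <-]|ny] := pselect (exists x, u x = y); first by rewrite uK uv vK.
rewrite !fpull_out // => x; apply/eqP => xy; apply: ny; exists x => //.
by rewrite uv.
Qed.

Lemma inj_smor_comp n m l (v : smor P m l) (u : smor P n m) :
  inj_smor v -> inj_smor u -> inj_smor (scomp v u).
Proof.
move=> [vI vK] [uI uK]; split=> [|x]; first exact: inj_comp.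
by rewrite fpull_comp alg_cmpE vK uK.
Qed.

Lemma inj_sbij n m (f : 'I_n -> 'I_m) (fb : bijective f) : inj_smor (sbij P fb).
Proof.
split=> [|x]; first exact: bij_inj.
rewrite fpull_gen mu_op_cast mu_one /=; congr free_gen.
by apply: (bij_inj fb); rewrite fibre_enumP.
Qed.

Lemma incl_inj n (K : {set 'I_n}) : injective (@incl n K).
Proof. exact: enum_val_inj. Qed.

Lemma inclP n (K : {set 'I_n}) x : reflect (exists k, @incl n K k = x) (x \in K).
Proof.
apply: (iffP idP) => [xK|[k <-]]; last exact: enum_valP.
by exists (enum_rank_in xK x); rewrite /incl enum_rankK_in.
Qed.

Lemma incl_in n (K : {set 'I_n}) k : @incl n K k \in K.
Proof. exact: enum_valP. Qed.

Lemma inj_sincl n (K : {set 'I_n}) : inj_smor (sincl unP K).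
Proof.
split=> [|k]; first exact: incl_inj.
rewrite fpull_gen mu_op_cast -[sincl unP K k]/(@incl n K k).
move: (esym _); rewrite incl_in => e; rewrite /unit_or_zero mu_one /=.
congr free_gen; apply: (@incl_inj _ K); exact: fibre_enumP.
Qed.

Lemma sincl_in n (K : {set 'I_n}) k :
  fpull (sincl unP K) (free_gen P (@incl n K k)) = free_gen P k.
Proof. exact: (proj2 (inj_sincl K)). Qed.

Lemma sincl_out n (K : {set 'I_n}) x : x \notin K ->
  fpull (sincl unP K) (free_gen P x) = azero (Fr 'I_#|K|).
Proof. by move=> xK; apply: fpull_out => k; apply: contraNneq xK => <-; apply: incl_in. Qed.

Lemma sincl_inclK n (K : {set 'I_n}) :
  alg_cmp (fpull (sincl unP K)) (fpush P (@incl n K)) = alg_id (Fr 'I_#|K|).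
Proof. by apply: free_hom_ext => k; rewrite alg_cmpE fpush_gen sincl_in. Qed.

Lemma sincl_mono n m (K : {set 'I_m}) (u v : smor P n #|K|) :
  scomp (sincl unP K) u = scomp (sincl unP K) v -> u = v.
Proof.
move=> e; apply: smor_ext => [x|].
  by apply: (@incl_inj _ K); apply: (congr1 (fun w : smor P n m => w x) e).
apply: free_hom_ext => k; rewrite -sincl_in -!alg_cmpE -!fpull_comp.
by rewrite e.
Qed.

(** The cast is along an equality of sets and not only of their cardinals, so
    that both sides use the same enumeration and no permutation appears. *)
Lemma mu_fibre_cast (A : algebra P) n (S T : {set 'I_n}) (e : S = T) (p : P #|S|)
    (x : 'I_n -> A) :
  mu (eq_rect S (fun S : {set 'I_n} => P #|S|) p T e) (x \o enum_val) =
  mu p (x \o enum_val).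
Proof. by case: _ / e. Qed.

(** Over the points outside [L] the fibres of [w] are empty, where the operations
    are forced; hence nothing is lost by forgetting them. *)
Lemma smor_corestr n m (w : smor P n m) (L : {set 'I_m}) :
  (forall x, w x \in L) -> exists v : smor P n #|L|, scomp (sincl unP L) v = w.
Proof.
move=> wL; pose v x := enum_rank_in (wL x) (w x).
have vE x : @incl _ L (v x) = w x by rewrite /incl enum_rankK_in.
have fib l : fibre w (@incl _ L l) = fibre v l.
  by apply/setP => x; rewrite !inE -vE (inj_eq (@incl_inj _ L)).
exists (@Smor P _ _ v (fun l => eq_rect _ (fun S : {set 'I_n} => P #|S|) (sop w _) _ (fib l))).
apply: smor_ext => //; apply: free_hom_ext => y.
have [/inclP[l <-]|yL] := boolP (y \in L).
  rewrite fpull_comp alg_cmpE sincl_in !fpull_gen; exact: mu_fibre_cast.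
have wy x : w x != y by apply: contraNneq yL => <-.
by rewrite [RHS]fpull_out // fpull_out // => x /=; rewrite vE.
Qed.

Lemma smor_restr n m (u : smor P n m) (K : {set 'I_n}) :
  exists v : opmor P #|K| #|u @: K|,
    scomp (sincl unP (u @: K)) (opmap v) = scomp u (sincl unP K).
Proof.
have [k|v ev] := @smor_corestr _ _ (scomp u (sincl unP K)) (u @: K).
  by apply/imset_f/incl_in.
have vs : surjb v.
  apply/surjP => l; have /imsetP[x /inclP[k <-] e] := incl_in l.
  exists k; apply: (@incl_inj _ (u @: K)); rewrite e.
  exact: (congr1 (fun w : smor P _ m => w k) ev).
by exists (Sub v vs).
Qed.

Lemma omor_restr_exists n m (f : 'I_n -> 'I_m) (K : {set 'I_n}) :
  exists h : omor #|K| #|f @: K|, @incl _ (f @: K) \o omap h = f \o @incl _ K.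
Proof.
have /(_ _)/inclP/cid fK k : f (@incl _ K k) \in f @: K by apply/imset_f/incl_in.
pose h k := projT1 (fK k).
have hE k : @incl _ (f @: K) (h k) = f (@incl _ K k) by exact: projT2 (fK k).
have hs : surjb h.
  apply/surjP => l; have /imsetP[x /inclP[k <-] e] := incl_in l.
  by exists k; apply: (@incl_inj _ (f @: K)); rewrite e.
by exists (Sub h hs); apply: funext => k /=; apply: hE.
Qed.

(** The restriction of a square to [K] and [L] has apex [R], the subset of the
    pullback lying over both. Over a point of [K] the word is the word of the
    large square with the letters outside [L] sent to zero, and a letter lies
    in [R] exactly when its image lies in [L]. *)
Lemma sq_restr A B C D (f : 'I_A -> 'I_B) (g : 'I_C -> 'I_D)
    (phi : smor P A C) (psi : smor P B D)
    (K : {set 'I_C}) (L : {set 'I_B}) (E : {set 'I_D}) (R : {set 'I_A})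
    (f' : 'I_#|R| -> 'I_#|L|) (g' : 'I_#|K| -> 'I_#|E|)
    (phi' : smor P #|R| #|K|) (psi' : smor P #|L| #|E|) :
  sq f g phi psi -> R = [set a | (phi a \in K) && (f a \in L)] ->
  @incl _ L \o f' = f \o @incl _ R -> @incl _ E \o g' = g \o @incl _ K ->
  scomp (sincl unP K) phi' = scomp phi (sincl unP R) ->
  scomp (sincl unP E) psi' = scomp psi (sincl unP L) ->
  sq f' g' phi' psi'.
Proof.
move=> [pb base] RE ff gg phph psps.
have fE r : @incl _ L (f' r) = f (@incl _ R r) by exact: (congr1 (fun w => w r) ff).
have gE k : @incl _ E (g' k) = g (@incl _ K k) by exact: (congr1 (fun w => w k) gg).
have phE r : @incl _ K (phi' r) = phi (@incl _ R r).
  exact: (congr1 (fun w : smor P _ _ => w r) phph).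
have psE l : @incl _ E (psi' l) = psi (@incl _ L l).
  exact: (congr1 (fun w : smor P _ _ => w l) psps).
split; first split.
- by move=> r; apply: (@incl_inj _ E); rewrite psE fE gE phE (pb_comm pb).
- move=> l k e.
  have [|a [[fa pa] aU]] := pb_univ pb (b := @incl _ L l) (c := @incl _ K k).
    by rewrite -psE e gE.
  have /inclP[r ra] : a \in R by rewrite RE inE fa pa !incl_in.
  exists r; split.
    by split; apply: incl_inj; rewrite ?fE ?phE ra.
  move=> r' [fr pr]; apply: (@incl_inj _ R); rewrite ra; apply: aU.
  by rewrite -fE -phE fr pr.
apply: free_hom_ext => k; rewrite !alg_cmpE fpush_gen.
rewrite -[free_gen P k]sincl_in -[free_gen P (g' k)]sincl_in.
rewrite -[fpull phi' _]alg_cmpE -[fpull psi' _]alg_cmpE -!fpull_comp phph psps.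
rewrite !fpull_comp !alg_cmpE gE -(fpush_gen P g) -[fpull psi _]alg_cmpE -base alg_cmpE.
rewrite fpull_gen !alg_funP; congr mu; apply: funext => j.
set x := fibre_enum phi (@incl _ K k) j.
rewrite -[LHS]/(fpush P f' (fpull (sincl unP R) (free_gen P x))).
rewrite -[RHS]/(fpull (sincl unP L) (fpush P f (free_gen P x))) fpush_gen.
have xR : (x \in R) = (f x \in L) by rewrite RE inE /x fibre_enumP incl_in.
have [/inclP[r rx]|nxR] := boolP (x \in R).
  by rewrite -rx sincl_in fpush_gen -fE sincl_in.
by rewrite sincl_out // alg_azero sincl_out // -xR.
Qed.

Section Rho.
Variable n : nat.

(** The composite of the restriction to [B] and the inclusion of [B], see
    [rho_incl]. Defining it on generators keeps the enumeration of [B] out of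
    the computations with these idempotents. *)
Definition rho (B : {set 'I_n}) : alg_hom (Fr 'I_n) (Fr 'I_n) :=
  lift (fun x => if x \in B then free_gen P x else azero (Fr 'I_n)).

Arguments rho : simpl never.

Lemma rho_gen B x :
  rho B (free_gen P x) = if x \in B then free_gen P x else azero (Fr 'I_n).
Proof. exact: lift_gen. Qed.

Lemma rhoT : rho setT = alg_id (Fr 'I_n).
Proof. by apply: free_hom_ext => x; rewrite rho_gen inE. Qed.

Lemma rhoI (A B : {set 'I_n}) : alg_cmp (rho A) (rho B) = rho (A :&: B).
Proof.
apply: free_hom_ext => x; rewrite alg_cmpE !rho_gen inE andbC.
by case: (x \in B); rewrite ?alg_azero ?rho_gen.
Qed.

Lemma rho_incl B : alg_cmp (fpush P (@incl _ B)) (fpull (sincl unP B)) = rho B.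
Proof.
apply: free_hom_ext => x; rewrite alg_cmpE rho_gen.
have [/inclP[k <-]|xB] := boolP (x \in B); first by rewrite sincl_in fpush_gen.
by rewrite sincl_out // alg_azero.
Qed.

End Rho.

Lemma rho_fpush n m (f : 'I_n -> 'I_m) (B : {set 'I_m}) :
  alg_cmp (rho B) (fpush P f) = alg_cmp (fpush P f) (rho (f @^-1: B)).
Proof.
apply: free_hom_ext => x; rewrite !alg_cmpE fpush_gen !rho_gen inE.
by case: ifP; rewrite ?fpush_gen ?alg_azero.
Qed.

(** If [y] is outside [B], all letters of its word are killed, and so is the
    word, by [mu_azero]. *)
Lemma fpull_rho n m (u : smor P n m) (B : {set 'I_m}) :
  alg_cmp (fpull u) (rho B) = alg_cmp (rho (u @^-1: B)) (fpull u).
Proof.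
apply: free_hom_ext => y; rewrite !alg_cmpE rho_gen fpull_gen alg_funP.
case: ifP => yB.
  rewrite fpull_gen; congr mu; apply: funext => j.
  rewrite -[RHS]/(rho _ (free_gen P (fibre_enum u y j))) rho_gen inE.
  by rewrite fibre_enumP yB.
rewrite alg_azero -(mu_azero _ (sop u y)); congr mu; apply: funext => j.
by rewrite -[RHS]/(rho _ (free_gen P (fibre_enum u y j))) rho_gen inE fibre_enumP yB.
Qed.

End Restriction.

(** * From pseudo-Mackey functors to functors *)

Section DependentProduct.
Local Open Scope ring_scope.
Variables (I : Type) (T : I -> zmodType).

Definition dprod := forall i, T i.

Implicit Types x y z : dprod.

HB.instance Definition _ := gen_eqMixin dprod.
HB.instance Definition _ := gen_choiceMixin dprod.

Let dadd x y : dprod := fun i => x i + y i.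
Let dopp x : dprod := fun i => - x i.
Let dzero : dprod := fun i => 0.

Let daddA : associative dadd.
Proof. by move=> x y z; apply: functional_extensionality_dep => i; apply: addrA. Qed.
Let daddC : commutative dadd.
Proof. by move=> x y; apply: functional_extensionality_dep => i; apply: addrC. Qed.
Let dadd0 : left_id dzero dadd.
Proof. by move=> x; apply: functional_extensionality_dep => i; apply: add0r. Qed.
Let daddN : left_inverse dzero dopp dadd.
Proof. by move=> x; apply: functional_extensionality_dep => i; apply: addNr. Qed.

HB.instance Definition _ := GRing.isZmodule.Build dprod daddA daddC dadd0 daddN.

Lemma dprodB x y i : (x - y) i = x i - y i. Proof. by []. Qed.

Definition dprod_eval i (x : dprod) : T i := x i.

HB.instance Definition _ i :=
  GRing.isZmodMorphism.Build dprod (T i) (dprod_eval i) (fun x y => dprodB x y i).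

End DependentProduct.

Section MackeyToFunctor.
Local Open Scope ring_scope.
Variables (P : operad) (unP : unitary P).
Local Notation "'Fr' X" := (free_algebra P X) (at level 10, X at level 8).

Section JanusLaws.
Variable M : janus P.

Lemma push_id n x : push M (oid n) x = x.
Proof.
have [e _] := push_functor M.
exact: (congr1 (fun h : {additive M n -> M n} => h x) (e n)).
Qed.

Lemma push_comp n m l (g : omor m l) (f : omor n m) x :
  push M (ocomp g f) x = push M g (push M f x).
Proof.
have [_ e] := push_functor M.
exact: (congr1 (fun h : {additive M n -> M l} => h x) (e _ _ _ g f)).
Qed.

Lemma pull_id n x : pull M (opid P n) x = x.
Proof.
have [e _] := pull_functor M.
exact: (congr1 (fun h : {additive M n -> M n} => h x) (e n)).
Qed.

Lemma pull_comp n m l (g : opmor P m l) (f : opmor P n m) x :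
  pull M (opcomp g f) x = pull M f (pull M g x).
Proof.
have [_ e] := pull_functor M.
exact: (congr1 (fun h : {additive M l -> M n} => h x) (e _ _ _ f g)).
Qed.

End JanusLaws.

(** The two components of a double isomorphism. *)
Definition obij n m (f : 'I_n -> 'I_m) (fb : bijective f) : omor n m :=
  Sub f (surj_bij fb).

Definition opbij n m (f : 'I_n -> 'I_m) (fb : bijective f) : opmor P n m :=
  Sub (sbij P fb) (surj_bij fb).

Variable M : pmackey unP.

Lemma push_pull_bij n m (f : 'I_n -> 'I_m) (fb : bijective f) x :
  push M (obij fb) (pull M (opbij fb) x) = x.
Proof.
have e := bij_card fb; case: _ / e in f fb x *.
have -> : obij fb = operm (perm (bij_inj fb)).
  by apply: val_inj; apply: funext => k /=; rewrite permE.
have -> : opbij fb = opperm P (perm (bij_inj fb)).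
  apply: val_inj; apply: (@inj_smor_eq _ unP) => [||k /=]; try exact: inj_sbij.
  by rewrite permE.
exact: (proj1 (pmackeyP M)).
Qed.

(** The action of [M] on a map restricted to [K] and [L], extended by zero to
    the pairs for which [L] is not the image of [K]. Totality makes these the
    entries of a matrix indexed by subsets, free of dependence on proofs. *)
Definition pushS n m (f : 'I_n -> 'I_m) (K : {set 'I_n}) (L : {set 'I_m}) :
    {additive M #|K| -> M #|L|} :=
  match pselect (exists h : omor #|K| #|L|, @incl _ L \o omap h = f \o @incl _ K) with
  | left e => push M (projT1 (cid e))
  | right _ => GRing.null_fun _
  end.

Definition pullS n m (u : smor P n m) (K : {set 'I_n}) (L : {set 'I_m}) :
    {additive M #|L| -> M #|K|} :=
  match pselect (exists v : opmor P #|K| #|L|,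
    scomp (sincl unP L) (opmap v) = scomp u (sincl unP K)) with
  | left e => pull M (projT1 (cid e))
  | right _ => GRing.null_fun _
  end.

Lemma pushSE n m (f : 'I_n -> 'I_m) (K : {set 'I_n}) (L : {set 'I_m})
    (h : omor #|K| #|L|) :
  @incl _ L \o omap h = f \o @incl _ K -> pushS f K L = push M h.
Proof.
move=> hf; rewrite /pushS; case: pselect => [e|[]]; last by exists h.
congr push; apply: val_inj; apply: funext => k; apply: (@incl_inj _ L).
exact: (congr1 (fun w => w k) (etrans (projT2 (cid e)) (esym hf))).
Qed.

Lemma pullSE n m (u : smor P n m) (K : {set 'I_n}) (L : {set 'I_m})
    (v : opmor P #|K| #|L|) :
  scomp (sincl unP L) (opmap v) = scomp u (sincl unP K) -> pullS u K L = pull M v.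
Proof.
move=> uv; rewrite /pullS; case: pselect => [e|[]]; last by exists v.
congr pull; apply: val_inj; apply: (@sincl_mono _ unP _ _ L).
exact: etrans (projT2 (cid e)) (esym uv).
Qed.

(** The composite attached to a subset [Q] can be computed with any enumeration
    [j] of [Q] in place of the increasing one: the two differ by a double
    isomorphism, which cancels. This matters because a subset of a subset has
    two sizes that are equal only propositionally. *)
Lemma push_pull_enum n a b c (f : 'I_a -> 'I_b) (phi : smor P a c)
    (K : {set 'I_c}) (L : {set 'I_b}) (Q : {set 'I_a})
    (h : omor n #|L|) (v : opmor P n #|K|) (j : smor P n a) x :
  inj_smor j -> j @: setT = Q -> f @: Q = L -> phi @: Q = K ->
  @incl _ L \o omap h = f \o j -> scomp (sincl unP K) (opmap v) = scomp phi j ->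
  push M h (pull M v x) = pushS f Q L (pullS phi Q K x).
Proof.
move=> [jI jK] jQ fQ phQ hE vE.
have [h' h'E] := omor_restr_exists f Q.
have [v' v'E] := smor_restr unP phi Q.
move: h' h'E v' v'E; rewrite fQ phQ => h' h'E v' v'E.
rewrite (pushSE h'E) (pullSE v'E).
have [i|s sE] := @smor_corestr _ unP _ _ j Q; first by rewrite -jQ imset_f.
have sjE i : @incl _ Q (s i) = j i by exact: (congr1 (fun w : smor P n a => w i) sE).
have sI : injective s by move=> i i' e; apply: jI; rewrite -!sjE e.
have sb : bijective s.
  apply: inj_card_bij => //; rewrite !card_ord -jQ (leq_trans (leq_imset_card _ _)) //.
  by rewrite cardsT card_ord.
have s_inj : inj_smor s.
  split=> // i; rewrite -[RHS]jK -sE fpull_comp alg_cmpE.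
  by rewrite -[scomp _ _ i]/(@incl _ Q (s i)) sincl_in.
have -> : h = ocomp h' (obij sb).
  apply: val_inj; apply: funext => i; apply: (@incl_inj _ L).
  rewrite -[LHS]/((@incl _ L \o omap h) i) hE /= -sjE.
  by rewrite -[RHS]/((@incl _ L \o omap h') (s i)) h'E.
have -> : v = opcomp v' (opbij sb).
  apply: val_inj; apply: (@sincl_mono _ unP _ _ K); rewrite [LHS]vE.
  rewrite -[val _]/(scomp (opmap v') (sbij P sb)) scompA v'E -scompA -sE.
  by congr (scomp _ (scomp _ _)); apply: (@inj_smor_eq _ unP) => //; apply: inj_sbij.
by rewrite push_comp pull_comp push_pull_bij.
Qed.

(** The Mackey formula for the square restricted to [K] and [L]. Its admissible
    subsets correspond to the subsets [Q] of the apex [a] of the large square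
    whose images are [L] and [K]. *)
Lemma mackey_restr a b c d (f : 'I_a -> 'I_b) (g : 'I_c -> 'I_d)
    (phi : smor P a c) (psi : smor P b d) (K : {set 'I_c}) (L : {set 'I_b}) x :
  sq f g phi psi -> g @: K = psi @: L ->
  pullS psi L (psi @: L) (pushS g K (psi @: L) x) =
  \sum_(Q : {set 'I_a} | (f @: Q == L) && (phi @: Q == K))
    pushS f Q L (pullS phi Q K x).
Proof.
move=> fsq gK; have [pb _] := fsq.
pose R := [set a | (phi a \in K) && (f a \in L)].
have fR : f @: R = L.
  apply/setP => l; apply/imsetP/idP => [[r + ->]|lL]; first by rewrite inE => /andP[].
  have /imsetP[k kK e] : psi l \in g @: K by rewrite gK imset_f.
  by have [r [[fr pr] _]] := pb_univ pb e; exists r; rewrite ?inE ?fr ?pr ?kK.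
have phR : phi @: R = K.
  apply/setP => k; apply/imsetP/idP => [[r + ->]|kK]; first by rewrite inE => /andP[].
  have /imsetP[l lL /esym e] : g k \in psi @: L by rewrite -gK imset_f.
  by have [r [[fr pr] _]] := pb_univ pb e; exists r; rewrite ?inE ?fr ?pr ?kK.
have [f' f'E] := omor_restr_exists f R; move: f' f'E; rewrite fR => f' f'E.
have [g' g'E] := omor_restr_exists g K; move: g' g'E; rewrite gK => g' g'E.
have [phi' phi'E] := smor_restr unP phi R; move: phi' phi'E; rewrite phR => phi' phi'E.
have [psi' psi'E] := smor_restr unP psi L.
have /is_squareP sq' := sq_restr fsq erefl f'E g'E phi'E psi'E.
rewrite (pushSE g'E) (pullSE psi'E) (proj2 (pmackeyP M) _ _ _ _ _ _ _ _ sq').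
(* Admissible subsets of [R], seen as subsets of the whole apex. *)
pose h (A : Adm f' phi') := @incl _ R @: val A.
pose h' (Q : {set 'I_a}) : option (Adm f' phi') := insub (@incl _ R @^-1: Q).
have hf (A : Adm f' phi') : f @: h A = L.
  rewrite -imset_comp; apply/setP => l; apply/imsetP/idP => [[r _ ->]|lL].
    by rewrite -f'E /=; apply: incl_in.
  have /inclP[i <-] := lL; have /andP[/surjP/(_ i)[r <-] _] := valP A.
  by exists (@incl _ (val A) r); rewrite ?incl_in // -f'E.
have hphi (A : Adm f' phi') : phi @: h A = K.
  have phE r : @incl _ K (opmap phi' r) = phi (@incl _ R r).
    exact: (congr1 (fun w : smor P _ _ => w r) phi'E).
  rewrite -imset_comp; apply/setP => k; apply/imsetP/idP => [[r _ ->]|kK].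
    by rewrite /= -phE; apply: incl_in.
  have /inclP[i <-] := kK; have /andP[_ /surjP/(_ i)[r <-]] := valP A.
  by exists (@incl _ (val A) r); rewrite ?incl_in //= -phE.
have hK (A : Adm f' phi') : @incl _ R @^-1: h A = val A.
  by apply/setP => r; rewrite inE mem_imset //; apply: incl_inj.
rewrite [RHS](reindex_omap h h') => [|Q /andP[/eqP fQ /eqP phQ]].
  apply: eq_big => [A|A _].
    by rewrite hf hphi !eqxx /h' hK valK eqxx.
  apply: (push_pull_enum (j := scomp (sincl unP R) (sincl unP (val A)))) => //.
  - by apply: inj_smor_comp; apply: inj_sincl.
  - have eA : @incl _ (val A) @: setT = val A.
      by apply/setP => r; apply/imsetP/inclP => [[i _ ->]|[i <-]]; exists i.
    by rewrite [LHS](imset_comp (@incl _ R) (@incl _ (val A))) eA.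
  - by apply: funext => i; rewrite -[RHS]/((f \o @incl _ R) (@incl _ (val A) i)) -f'E.
  - by rewrite [RHS]scompA -phi'E -scompA.
have QR : Q \subset R.
  by apply/subsetP => q qQ; rewrite inE -phQ -fQ !imset_f.
have hQ : @incl _ R @: (@incl _ R @^-1: Q) = Q.
  apply/setP => q; apply/imsetP/idP => [[r + ->]|qQ]; first by rewrite inE.
  by have /inclP[r rq] := subsetP QR q qQ; exists r; rewrite // inE rq.
have adm : admissible f' phi' (@incl _ R @^-1: Q).
  apply/andP; split; apply/surjP => i.
    have /imsetP[q qQ e] : @incl _ L i \in f @: Q by rewrite fQ incl_in.
    have /inclP[r rq] := subsetP QR q qQ.
    have /inclP[k kr] : r \in @incl _ R @^-1: Q by rewrite inE rq.
    exists k; apply: (@incl_inj _ L); rewrite e -rq -kr.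
    by rewrite -[RHS]/((f \o @incl _ R) (incl k)) -f'E.
  have /imsetP[q qQ e] : @incl _ K i \in phi @: Q by rewrite phQ incl_in.
  have /inclP[r rq] := subsetP QR q qQ.
  have /inclP[k kr] : r \in @incl _ R @^-1: Q by rewrite inE rq.
  exists k; apply: (@incl_inj _ K); rewrite e -rq -kr.
  exact: (congr1 (fun w : smor P _ _ => w (incl k)) phi'E).
rewrite /h' /= (insubT _ adm) /=; congr Some.
exact: hQ.
Qed.

(** The functor assembled from [M]: in degree [n], one copy of [M] for each
    subset. Under [assembly] a map sends the component at [K] to the component
    at its image, and a morphism of [S(P)] reads the component at the image. *)
Definition assembly_obj n : zmodType := dprod (fun K : {set 'I_n} => M #|K|).

Definition tpush_fun n m (f : 'I_n -> 'I_m) (x : assembly_obj n) : assembly_obj m :=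
  fun L => \sum_(K : {set 'I_n} | f @: K == L) pushS f K L (x K).

Definition tpull_fun n m (u : smor P n m) (x : assembly_obj m) : assembly_obj n :=
  fun K => pullS u K (u @: K) (x (u @: K)).

Lemma tpush_additive n m (f : 'I_n -> 'I_m) : zmod_morphism (tpush_fun f).
Proof.
move=> x y; apply: functional_extensionality_dep => L.
rewrite dprodB /tpush_fun -sumrB; apply: eq_bigr => K _.
by rewrite dprodB raddfB.
Qed.

HB.instance Definition _ n m (f : 'I_n -> 'I_m) :=
  GRing.isZmodMorphism.Build _ _ (tpush_fun f) (@tpush_additive n m f).

Lemma tpull_additive n m (u : smor P n m) : zmod_morphism (tpull_fun u).
Proof.
move=> x y; apply: functional_extensionality_dep => K.
by rewrite dprodB /tpull_fun dprodB raddfB.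
Qed.

HB.instance Definition _ n m (u : smor P n m) :=
  GRing.isZmodMorphism.Build _ _ (tpull_fun u) (@tpull_additive n m u).

Definition tpush n m (f : 'I_n -> 'I_m) : {additive assembly_obj n -> assembly_obj m} := tpush_fun f.
Definition tpull n m (u : smor P n m) : {additive assembly_obj m -> assembly_obj n} := tpull_fun u.

Lemma pushS_comp a b c (g : 'I_b -> 'I_c) (f : 'I_a -> 'I_b) (K : {set 'I_a}) x :
  pushS (g \o f) K (g @: (f @: K)) x = pushS g (f @: K) (g @: (f @: K)) (pushS f K (f @: K) x).
Proof.
have [f' f'E] := omor_restr_exists f K.
have [g' g'E] := omor_restr_exists g (f @: K).
rewrite (pushSE f'E) (pushSE g'E) -push_comp (pushSE (h := ocomp g' f')) //.
by apply: funext => k; rewrite -[RHS]/(g ((f \o @incl _ K) k)) -f'E -[RHS]/((g \o @incl _ _) (omap f' k)) -g'E.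
Qed.

Lemma pullS_comp a b c (v : smor P b c) (u : smor P a b) (K : {set 'I_a}) x :
  pullS (scomp v u) K (v @: (u @: K)) x = pullS u K (u @: K) (pullS v (u @: K) (v @: (u @: K)) x).
Proof.
have [u' u'E] := smor_restr unP u K.
have [v' v'E] := smor_restr unP v (u @: K).
rewrite (pullSE u'E) (pullSE v'E) -pull_comp (pullSE (v := opcomp v' u')) //.
by rewrite -[LHS]/(scomp _ (scomp (opmap v') (opmap u'))) scompA v'E -scompA u'E scompA.
Qed.

Lemma pushS_id n (K : {set 'I_n}) x : pushS id K K x = x.
Proof. by rewrite (@pushSE _ _ id K K (oid _)) ?push_id. Qed.

Lemma pullS_id n (K : {set 'I_n}) x : pullS (sid P n) K K x = x.
Proof.
rewrite (@pullSE _ _ (sid P n) K K (opid P _)) ?pull_id //.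
exact: etrans (scompm1 _) (esym (scomp1m _)).
Qed.

Lemma tpush_id n x : tpush (@id 'I_n) x = x.
Proof.
apply: functional_extensionality_dep => L; rewrite /= /tpush_fun.
rewrite (eq_bigl (pred1 L)) => [|K]; last by rewrite imset_id.
by rewrite big_pred1_eq pushS_id.
Qed.

Lemma tpush_comp a b c (g : 'I_b -> 'I_c) (f : 'I_a -> 'I_b) x :
  tpush (g \o f) x = tpush g (tpush f x).
Proof.
apply: functional_extensionality_dep => L; rewrite /= /tpush_fun.
rewrite (partition_big (fun K : {set 'I_a} => f @: K) (fun K' => g @: K' == L)) => [|K].
  apply: eq_bigr => K' /eqP <-; rewrite raddf_sum; apply: eq_big => K.
    by rewrite imset_comp; case: (f @: K =P K') => [->|]; rewrite ?eqxx ?andbF.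
  by move=> /andP[_ /eqP <-]; apply: pushS_comp.
by rewrite imset_comp.
Qed.

Lemma tpull_id n x : tpull (sid P n) x = x.
Proof.
by apply: functional_extensionality_dep => K; rewrite /= /tpull_fun imset_id pullS_id.
Qed.

Lemma tpull_comp a b c (v : smor P b c) (u : smor P a b) x :
  tpull (scomp v u) x = tpull u (tpull v x).
Proof.
apply: functional_extensionality_dep => K; rewrite /= /tpull_fun.
by rewrite [scomp v u @: K](imset_comp v u) pullS_comp.
Qed.

(** Both sides are sums over subsets of the pullback, which on the left are
    grouped by their image in ['I_c]. *)
Lemma tpull_tpush a b c d (f : 'I_a -> 'I_b) (g : 'I_c -> 'I_d)
    (phi : smor P a c) (psi : smor P b d) x :
  sq f g phi psi -> tpull psi (tpush g x) = tpush f (tpull phi x).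
Proof.
move=> fsq; apply: functional_extensionality_dep => L; rewrite /= /tpull_fun /tpush_fun.
rewrite raddf_sum [RHS](partition_big (fun Q : {set 'I_a} => phi @: Q)
  (fun K => g @: K == psi @: L)) => [|Q /eqP <-]; last first.
  rewrite -!imset_comp; apply/eqP/eq_imset => q /=.
  by rewrite (pb_comm (sq_pb fsq)).
apply: eq_bigr => K /eqP gK; rewrite (mackey_restr _ fsq gK).
by apply: eq_bigr => Q /andP[_ /eqP <-].
Qed.

Lemma span_pick n m (al : alg_hom (Fr 'I_n) (Fr 'I_m)) :
  exists s : {k : nat & (('I_k -> 'I_m) * smor P k n)%type},
    al = alg_cmp (fpush P (tagged s).1) (fpull (tagged s).2).
Proof.
by have [k [g [u e]]] := span_exists al; exists (existT _ k (g, u)).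
Qed.

(** A span that represents [al] is chosen; [assembly_mapE] shows that every
    other span gives the same map. *)
Definition assembly_map n m (al : alg_hom (Fr 'I_n) (Fr 'I_m)) :
    {additive assembly_obj n -> assembly_obj m} :=
  let s := tagged (projT1 (cid (span_pick al))) in tpush s.1 \o tpull s.2.

Lemma assembly_mapE n m k (g : 'I_k -> 'I_m) (u : smor P k n) x :
  assembly_map (alg_cmp (fpush P g) (fpull u)) x = tpush g (tpull u x).
Proof.
rewrite /assembly_map; case: (cid _) => -[k' [g' u']] /= e.
have [t [<- tsq]] := span_unique (esym e).
rewrite -[LHS]/(tpush g' (tpull u' x)) -[tpull u' x]tpush_id.
by rewrite -[RHS]/(tpush _ (tpull u x)) tpush_comp -(tpull_tpush _ tsq) !tpush_id.
Qed.

Lemma assembly_map_fpush n m (f : 'I_n -> 'I_m) x : assembly_map (fpush P f) x = tpush f x.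
Proof.
have -> : fpush P f = alg_cmp (fpush P f) (fpull (sid P n)).
  by rewrite fpull_id; apply: alg_hom_eq.
by rewrite assembly_mapE tpull_id.
Qed.

Lemma assembly_map_fpull n m (u : smor P n m) x : assembly_map (fpull u) x = tpull u x.
Proof.
have -> : fpull u = alg_cmp (fpush P id) (fpull u) by rewrite fpush_id; apply: alg_hom_eq.
by rewrite assembly_mapE tpush_id.
Qed.

Lemma assembly_map_id n x : assembly_map (alg_id (Fr 'I_n)) x = x.
Proof. by rewrite -fpush_id assembly_map_fpush tpush_id. Qed.

Lemma assembly_map_comp n m l (be : alg_hom (Fr 'I_m) (Fr 'I_l))
    (al : alg_hom (Fr 'I_n) (Fr 'I_m)) x :
  assembly_map (alg_cmp be al) x = assembly_map be (assembly_map al x).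
Proof.
have [k [g [u ->]]] := span_exists al; have [k' [h [v ->]]] := span_exists be.
have [q [f [phi fsq]]] := sq_exists g v.
have -> : alg_cmp (alg_cmp (fpush P h) (fpull v)) (alg_cmp (fpush P g) (fpull u)) =
    alg_cmp (fpush P (h \o f)) (fpull (scomp u phi)).
  rewrite fpush_comp fpull_comp; apply: alg_hom_eq => y; rewrite !alg_cmpE.
  by rewrite -[fpull v (fpush P g _)]alg_cmpE -(sq_base fsq).
by rewrite !assembly_mapE (tpull_tpush _ fsq) tpush_comp tpull_comp.
Qed.

Lemma assembly_map_functor : @is_functor (Free P) Ab assembly_obj assembly_map.
Proof.
split=> [n|a b c be al]; apply: additive_eq => x; first exact: assembly_map_id.
exact: assembly_map_comp.
Qed.

Definition assembly : functor (Free P) Ab := Functor assembly_map_functor.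

End MackeyToFunctor.

(** * From functors to pseudo-Mackey functors *)

Section SignedSums.
Local Open Scope ring_scope.

(** The involution that adds or removes [a] reverses the sign of the terms. *)
Lemma signed_sum0 (V : zmodType) (I : finType) (a : I) (F : {set I} -> V) :
  (forall A : {set I}, a \in A -> F (A :\ a) = - F A) -> \sum_(A : {set I}) F A = 0.
Proof.
move=> Fa; rewrite (bigID (fun A : {set I} => a \in A)) /=.
rewrite [X in _ + X](reindex_onto (fun A => A :\ a) (fun A => a |: A)) => [|A aA] /=.
  rewrite [X in _ + X](eq_big (fun A : {set I} => a \in A) (fun A => - F A)).
  - by rewrite sumrN subrr.
  - move=> A; rewrite !inE eqxx /=; apply/eqP/idP => [<-|aA]; first by rewrite setU11.
    exact: setD1K.
  - by move=> A; rewrite !inE eqxx /= => /eqP e; apply: Fa; rewrite -e setU11.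
by rewrite setU1K.
Qed.

Lemma sum_sign_supset (I : finType) (B : {set I}) :
  \sum_(A : {set I} | B \subset A) (-1) ^+ #|A :\: B| = (B == setT)%:R :> int.
Proof.
have [->|/eqP BT] := eqVneq B setT.
  by rewrite (big_pred1 setT) ?setDv ?cards0 // => A; rewrite subTset.
have [a aB] : exists a, a \notin B.
  by apply/existsP; rewrite -negb_forall; apply/negP => /forallP BA; apply: BT; apply/setP => a; rewrite BA inE.
rewrite big_mkcond; apply: (@signed_sum0 _ _ a) => A aA.
have -> : (B \subset A :\ a) = (B \subset A) by rewrite subsetD1 aB andbT.
case: ifP => [_|]; last by rewrite oppr0.
have -> : A :\ a :\: B = A :\: B :\ a by rewrite !setDDl setUC.
have : a \in A :\: B by rewrite inE aB.
by move=> aAB; rewrite [in RHS](cardsD1 a) aAB exprS mulN1r opprK.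
Qed.

End SignedSums.

Section CrossEffect.
Local Open Scope ring_scope.
Variables (P : operad) (unP : unitary P) (T : functor (Free P) Ab).
Local Notation "'Fr' X" := (free_algebra P X) (at level 10, X at level 8).

(** [T n] and [fmap T], retyped so that the structure of abelian group of the
    values is visible. *)
Definition tobj n : zmodType := T n.

Definition tmap n m (al : alg_hom (Fr 'I_n) (Fr 'I_m)) : {additive tobj n -> tobj m} :=
  @fmap (Free P) Ab T n m al.

Lemma tmap_id n x : tmap (alg_id (Fr 'I_n)) x = x.
Proof.
exact: (congr1 (fun h : {additive tobj n -> tobj n} => h x) (@fmap1 (Free P) Ab T n)).
Qed.

Lemma tmap_comp n m l (be : alg_hom (Fr 'I_m) (Fr 'I_l))
    (al : alg_hom (Fr 'I_n) (Fr 'I_m)) x :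
  tmap (alg_cmp be al) x = tmap be (tmap al x).
Proof.
exact: (congr1 (fun h : {additive tobj n -> tobj l} => h x)
  (@fmap_cmp (Free P) Ab T n m l be al)).
Qed.

(** Vanishing is required on the maximal proper subsets only; [crP] extends it
    to all proper subsets. *)
Definition cr_pred n : {pred tobj n} :=
  [pred x | [forall a : 'I_n, tmap (rho unP (~: [set a])) x == 0]].

Lemma crP n x : reflect (forall B, B != setT -> tmap (rho unP B) x = 0) (x \in @cr_pred n).
Proof.
apply: (iffP forallP) => [xa B BT|xB a]; last first.
  apply/eqP/xB; apply: contraTneq (in_setT a) => <-.
  by rewrite !inE eqxx.
have [a aB] : exists a, a \notin B.
  apply/existsP; rewrite -negb_forall; apply: contraNN BT => /forallP BA.
  by apply/eqP/setP => a; rewrite BA inE.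
have -> : B = B :&: ~: [set a].
  by apply/setP => b; rewrite !inE; case: (b =P a) => [->|]; rewrite ?(negPf aB) ?andbT.
by rewrite -rhoI tmap_comp (eqP (xa a)) raddf0.
Qed.

Lemma cr_zmod_closed n : zmod_closed (@cr_pred n).
Proof.
split=> [|x y /crP x0 /crP y0]; apply/crP => B BT; first by rewrite raddf0.
by rewrite raddfB x0 // y0 // subrr.
Qed.

HB.instance Definition _ n := GRing.isZmodClosed.Build (tobj n) (@cr_pred n) (@cr_zmod_closed n).

Record cr n := Cr { cr_val : tobj n; cr_valP : cr_val \in @cr_pred n }.

HB.instance Definition _ n := [isSub for @cr_val n].
HB.instance Definition _ n := [Choice of cr n by <:].
HB.instance Definition _ n := [SubChoice_isSubZmodule of cr n by <:].

Definition sgn n (B : {set 'I_n}) : int := (-1) ^+ #|~: B|.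

(** The expansion of the product of the [id - T(rho (~: [set a]))] over all [a]:
    the projection onto the cross effect. *)
Definition cr_proj_fun n (x : tobj n) : tobj n :=
  \sum_(B : {set 'I_n}) tmap (rho unP B) x *~ sgn B.

Lemma cr_proj_additive n : zmod_morphism (@cr_proj_fun n).
Proof.
move=> x y; rewrite /cr_proj_fun -sumrB; apply: eq_bigr => B _.
by rewrite raddfB mulrzBl.
Qed.

HB.instance Definition _ n :=
  GRing.isZmodMorphism.Build _ _ (@cr_proj_fun n) (@cr_proj_additive n).

Definition cr_proj n : {additive tobj n -> tobj n} := @cr_proj_fun n.

Lemma sgn_toggle n (B : {set 'I_n}) a : a \in B -> sgn (B :\ a) = - sgn B.
Proof.
move=> aB; rewrite /sgn; have -> : ~: (B :\ a) = a |: ~: B.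
  by apply/setP => b; rewrite !inE negb_and negbK.
by rewrite cardsU1 inE aB exprS mulN1r.
Qed.

Lemma sgn_setT n : sgn [set: 'I_n] = 1.
Proof. by rewrite /sgn setCT cards0. Qed.

(** If the terms depend on [B] only through [B :&: C], then for [a] outside [C]
    the terms of [B] and [B :\ a] cancel. *)
Lemma signed_rho_sum0 n (C : {set 'I_n}) (F : {set 'I_n} -> tobj n) : C != setT ->
  (forall B, F B = F (B :&: C)) -> \sum_(B : {set 'I_n}) F B *~ sgn B = 0.
Proof.
move=> CT FC; have [a aC] : exists a, a \notin C.
  apply/existsP; rewrite -negb_forall; apply: contraNN CT => /forallP CA.
  by apply/eqP/setP => a; rewrite CA inE.
apply: (@signed_sum0 _ _ a) => B aB; rewrite sgn_toggle // mulrNz; congr (- (_ *~ _)).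
rewrite FC [RHS]FC; congr F; apply/setP => b; rewrite !inE.
by case: (b =P a) => // ->; rewrite (negPf aC) !andbF.
Qed.

Lemma cr_proj_in n x : cr_proj n x \in @cr_pred n.
Proof.
apply/crP => C CT; rewrite /= /cr_proj_fun raddf_sum.
under eq_bigr => B _ do rewrite raddfMz -tmap_comp rhoI.
by apply: signed_rho_sum0 CT _ => B; rewrite [B :&: C]setIC setIA setIid.
Qed.

Lemma cr_proj_rho n x (C : {set 'I_n}) : C != setT -> cr_proj n (tmap (rho unP C) x) = 0.
Proof.
move=> CT; rewrite /= /cr_proj_fun.
under eq_bigr => B _ do rewrite -tmap_comp rhoI.
by apply: signed_rho_sum0 CT _ => B; rewrite -setIA setIid.
Qed.

Lemma cr_projE n x :
  cr_proj n x = x + \sum_(B : {set 'I_n} | B != setT) tmap (rho unP B) x *~ sgn B.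
Proof. by rewrite /= /cr_proj_fun (bigD1 setT) //= rhoT tmap_id sgn_setT. Qed.

Lemma cr_proj_id n x : x \in @cr_pred n -> cr_proj n x = x.
Proof.
move=> /crP x0; rewrite cr_projE big1 ?addr0 // => B BT.
by rewrite x0 // mul0rz.
Qed.

Lemma codom_setT n m (f : 'I_n -> 'I_m) : ~~ surjb f -> f @: setT != setT.
Proof.
apply: contraNN => /eqP fT; apply/surjP => y.
have /imsetP[x _ ->] : y \in f @: setT by rewrite fT inE.
by exists x.
Qed.

Lemma preimset_imsetT n m (f : 'I_n -> 'I_m) : f @^-1: (f @: setT) = setT.
Proof. by apply/setP => x; rewrite !inE imset_f. Qed.

Lemma preimset_neqT n m (f : 'I_n -> 'I_m) (B : {set 'I_m}) :
  surjb f -> B != setT -> f @^-1: B != setT.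
Proof.
move=> /surjP fs; apply: contraNN => /eqP fB; apply/eqP/setP => y.
have [x <-] := fs y; have : x \in f @^-1: B by rewrite fB inE.
by rewrite !inE.
Qed.

Lemma cr_proj_fpush n m (f : 'I_n -> 'I_m) x :
  ~~ surjb f -> cr_proj m (tmap (fpush P f) x) = 0.
Proof.
move=> /codom_setT fT; rewrite -[RHS](cr_proj_rho (tmap (fpush P f) x) fT).
by rewrite -tmap_comp rho_fpush preimset_imsetT rhoT tmap_comp tmap_id.
Qed.

(** [fpull u] factors through killing the generators outside the image of
    [u]. *)
Lemma tmap_fpull0 n m (u : smor P n m) x :
  ~~ surjb u -> x \in @cr_pred m -> tmap (fpull u) x = 0.
Proof.
move=> /codom_setT uT /crP/(_ _ uT) x0.
have -> : fpull u = alg_cmp (fpull u) (rho unP (u @: setT)).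
  by rewrite fpull_rho preimset_imsetT rhoT; apply: alg_hom_eq.
by rewrite tmap_comp x0 raddf0.
Qed.

(** The corrections that the projection adds in degree [m] are killed in degree
    [n], because preimages of proper subsets under a surjection are proper.
    This makes the contravariant action on cross effects functorial. *)
Lemma cr_proj_fpull n m (u : smor P n m) x : surjb u ->
  cr_proj n (tmap (fpull u) (cr_proj m x)) = cr_proj n (tmap (fpull u) x).
Proof.
move=> us; rewrite (cr_projE x) -[RHS]addr0 !raddfD; congr (_ + _).
rewrite !raddf_sum big1 // => B BT.
rewrite !raddfMz -tmap_comp fpull_rho tmap_comp cr_proj_rho ?mul0rz //.
exact: preimset_neqT.
Qed.

Lemma fpush_cr n m (f : 'I_n -> 'I_m) x :
  surjb f -> x \in @cr_pred n -> tmap (fpush P f) x \in @cr_pred m.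
Proof.
move=> fs /crP x0; apply/crP => B BT.
by rewrite -tmap_comp rho_fpush tmap_comp x0 ?raddf0 //; apply: preimset_neqT.
Qed.

(** Inclusion-exclusion: the term of [A] is the signed sum of the [T(rho B)] for
    [B \subset A], and after exchanging the sums only [B = setT] survives. *)
Lemma cr_decomposition n (x : tobj n) :
  x = \sum_(A : {set 'I_n})
        tmap (fpush P (@incl _ A)) (cr_proj #|A| (tmap (fpull (sincl unP A)) x)).
Proof.
have term (A : {set 'I_n}) :
    tmap (fpush P (@incl _ A)) (cr_proj #|A| (tmap (fpull (sincl unP A)) x)) =
    \sum_(B : {set 'I_n} | B \subset A) tmap (rho unP B) x *~ ((-1) ^+ #|A :\: B|).
  rewrite /= /cr_proj_fun raddf_sum.
  rewrite [RHS](reindex_onto (fun C : {set 'I_#|A|} => @incl _ A @: C)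
    (fun B : {set 'I_n} => @incl _ A @^-1: B)) => [|B BA]; last first.
    apply/setP => b; apply/imsetP/idP => [[k + ->]|bB]; first by rewrite inE.
    by have /inclP[k kb] := subsetP BA b bB; exists k; rewrite // inE kb.
  apply: eq_big => C; last move=> _.
    apply/esym/andP; split.
      by apply/subsetP => b /imsetP[k _ ->]; apply: incl_in.
    by apply/eqP/setP => k; rewrite inE mem_imset //; apply: incl_inj.
  rewrite raddfMz -!tmap_comp; congr (tmap _ x *~ (-1) ^+ _).
    apply: free_hom_ext => y; rewrite !alg_cmpE rho_gen.
    have [/inclP[k <-]|yA] := boolP (y \in A).
      rewrite sincl_in rho_gen mem_imset; last exact: incl_inj.
      by case: ifP; rewrite ?fpush_gen ?alg_azero.
    rewrite sincl_out // !alg_azero ifN //; apply: contraNN yA => /imsetP[k _ ->].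
    exact: incl_in.
  rewrite -(card_imset (~: C) (@incl_inj _ A)); congr #|pred_of_set _|; apply/setP => b.
  rewrite !inE; apply/imsetP/andP => [[k + ->]|[bC /inclP[k kb]]].
    by rewrite inE mem_imset ?incl_in //; apply: incl_inj.
  by exists k; rewrite // inE; apply: contraNN bC => kC; rewrite -kb imset_f.
under eq_bigr => A _ do rewrite term.
rewrite (exchange_big_dep predT) //=.
under eq_bigr => B _ do rewrite -mulrz_sumr sum_sign_supset.
rewrite (bigD1 setT) //= eqxx rhoT tmap_id big1 ?addr0 // => B /negPf ->.
by rewrite mulr0z.
Qed.

Lemma cr_val_inj n : injective (@cr_val n). Proof. exact: val_inj. Qed.

Definition cr_push_fun n m (f : omor n m) (x : cr n) : cr m :=
  Cr (fpush_cr (valP f) (cr_valP x)).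

Definition cr_pull_fun n m (u : opmor P n m) (x : cr m) : cr n :=
  Cr (cr_proj_in (tmap (fpull (opmap u)) (cr_val x))).

Lemma cr_valB n (x y : cr n) : cr_val (x - y) = cr_val x - cr_val y.
Proof. exact: (raddfB (val : {additive cr n -> tobj n})). Qed.

Lemma cr_val_sum n (I : Type) (r : seq I) (Q : pred I) (F : I -> cr n) :
  cr_val (\sum_(i <- r | Q i) F i) = \sum_(i <- r | Q i) cr_val (F i).
Proof. exact: (raddf_sum (val : {additive cr n -> tobj n})). Qed.

Lemma cr_push_additive n m (f : omor n m) : zmod_morphism (cr_push_fun f).
Proof. by move=> x y; apply: cr_val_inj; rewrite cr_valB -[LHS]/(tmap (fpush P (omap f)) (cr_val (x - y))) cr_valB raddfB. Qed.

Lemma cr_pull_additive n m (u : opmor P n m) : zmod_morphism (cr_pull_fun u).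
Proof. by move=> x y; apply: cr_val_inj; rewrite cr_valB -[LHS]/(cr_proj n (tmap (fpull (opmap u)) (cr_val (x - y)))) cr_valB !raddfB. Qed.

HB.instance Definition _ n m (f : omor n m) :=
  GRing.isZmodMorphism.Build _ _ (cr_push_fun f) (cr_push_additive f).

HB.instance Definition _ n m (u : opmor P n m) :=
  GRing.isZmodMorphism.Build _ _ (cr_pull_fun u) (cr_pull_additive u).

Definition cr_push n m (f : omor n m) : {additive cr n -> cr m} := cr_push_fun f.
Definition cr_pull n m (u : opmor P n m) : {additive cr m -> cr n} := cr_pull_fun u.

Lemma cr_pushE n m (f : omor n m) x :
  cr_val (cr_push f x) = tmap (fpush P (omap f)) (cr_val x).
Proof. by []. Qed.

Lemma cr_pullE n m (u : opmor P n m) x :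
  cr_val (cr_pull u x) = cr_proj n (tmap (fpull (opmap u)) (cr_val x)).
Proof. by []. Qed.

Lemma cr_push_functor : @is_functor Omega Ab cr cr_push.
Proof.
split=> [n|a b c g f]; apply: additive_eq => x; apply: cr_val_inj.
  by rewrite cr_pushE fpush_id tmap_id.
by rewrite cr_pushE -[omap _]/(omap g \o omap f) fpush_comp tmap_comp.
Qed.

Lemma cr_pull_id n x : cr_pull (opid P n) x = x.
Proof. by apply: cr_val_inj; rewrite cr_pullE fpull_id tmap_id cr_proj_id ?cr_valP. Qed.

Lemma cr_pull_comp a b c (v : opmor P b c) (u : opmor P a b) x :
  cr_pull (opcomp v u) x = cr_pull u (cr_pull v x).
Proof.
apply: cr_val_inj; rewrite !cr_pullE cr_proj_fpull ?(valP u) //.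
by rewrite -[opmap _]/(scomp (opmap v) (opmap u)) fpull_comp tmap_comp.
Qed.

Lemma cr_pull_functor :
  @is_functor (opposite (OmegaP P)) Ab cr (fun a b u => cr_pull u).
Proof.
split=> [n|a b c g f]; apply: additive_eq => x; first exact: cr_pull_id.
exact: cr_pull_comp.
Qed.

Definition cr_janus : janus P := Janus cr_push_functor cr_pull_functor.

(** By base change, the left-hand side is the projection of
    [T(fpush f)] applied to [T(fpull phi) x]. Decomposing the latter over the
    subsets [A] of the apex, the term of [A] vanishes if [f] is not surjective
    on [A], by the projection, or if [phi] is not, since [x] lies in the cross
    effect. On the admissible terms the projection is the identity. *)
Lemma cr_pseudo_mackey : pseudo_mackey unP cr_janus.
Proof.
split=> [n s x|a b c d f g phi psi /is_squareP[_ base] x]; apply: cr_val_inj.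
  rewrite [LHS]cr_pushE cr_pullE.
  have sE : fpull (sbij P (perm_bij s)) = fpush P (s^-1)%g.
    apply: free_hom_ext => y; rewrite fpush_gen -{1}(permKV s y).
    exact: (proj2 (inj_sbij P (perm_bij s))).
  rewrite -[opmap _]/(sbij P (perm_bij s)) sE cr_proj_id.
    rewrite -tmap_comp -fpush_comp; have -> : omap (operm s) \o (s^-1)%g = id.
      by apply: funext => y; apply: permKV.
    by rewrite fpush_id tmap_id.
  by apply: fpush_cr; [exact/surj_bij/perm_bij | exact: cr_valP].
rewrite cr_val_sum [LHS]cr_pullE cr_pushE -tmap_comp -base tmap_comp.
rewrite (cr_decomposition (tmap _ (cr_val x))) !raddf_sum.
pose F (A : {set 'I_a}) := cr_proj b (tmap (fpush P (omap f \o @incl _ A))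
  (cr_proj #|A| (tmap (fpull (scomp (opmap phi) (sincl unP A))) (cr_val x)))).
rewrite (eq_bigr F) => [|A _]; last first.
  by rewrite /F fpush_comp fpull_comp !tmap_comp.
rewrite (bigID (admissible f phi)) /= [X in _ + X]big1 ?addr0 => [|A]; last first.
  rewrite negb_and /F => /orP[nf|nphi]; first exact: cr_proj_fpush.
  by rewrite tmap_fpull0 ?cr_valP // !raddf0.
rewrite (reindex_omap (fun A : Adm f phi => val A) insub) => [|A fA]; last by rewrite insubT.
apply: eq_big => [A|A _]; first by rewrite (valP A) valK eqxx.
rewrite /F cr_proj_id //; apply: fpush_cr (cr_proj_in _).
by case/andP: (valP A).
Qed.

Definition cr_mackey : pmackey unP := PMackey cr_pseudo_mackey.

End CrossEffect.

Arguments cr_pred [P] unP T n _.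

(** * The equivalence *)

Section Equivalence.
Local Open Scope ring_scope.
Variables (P : operad) (unP : unitary P).
Local Notation "'Fr' X" := (free_algebra P X) (at level 10, X at level 8).

Section CrossEffectMap.
Variables (T T' : functor (Free P) Ab) (s : nat_trans T T').

Definition nt_add n : {additive tobj T n -> tobj T' n} := s n.

Lemma nt_tmap n m (al : alg_hom (Fr 'I_n) (Fr 'I_m)) x :
  nt_add m (tmap T al x) = tmap T' al (nt_add n x).
Proof.
exact: (congr1 (fun h : {additive tobj T n -> tobj T' m} => h x)
  (@ntP (Free P) Ab T T' s n m al)).
Qed.

Lemma nt_cr n x : x \in cr_pred unP T n -> nt_add n x \in cr_pred unP T' n.
Proof. by move=> /crP x0; apply/crP => B BT; rewrite -nt_tmap x0 ?raddf0. Qed.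

Definition cr_hom_fun n (x : cr unP T n) : cr unP T' n := Cr (nt_cr (cr_valP x)).

Lemma cr_hom_additive n : zmod_morphism (@cr_hom_fun n).
Proof.
move=> x y; apply: cr_val_inj.
by rewrite cr_valB -[LHS]/(nt_add n (cr_val (x - y))) cr_valB raddfB.
Qed.

HB.instance Definition _ n :=
  GRing.isZmodMorphism.Build _ _ (@cr_hom_fun n) (@cr_hom_additive n).

Definition cr_add n : {additive cr unP T n -> cr unP T' n} := @cr_hom_fun n.

Lemma cr_hom_push a b (f : omor a b) x :
  cr_add b (cr_push unP T f x) = cr_push unP T' f (cr_add a x).
Proof. by apply: cr_val_inj; rewrite [RHS]cr_pushE -nt_tmap. Qed.

Lemma nt_cr_proj n x : nt_add n (cr_proj unP T n x) = cr_proj unP T' n (nt_add n x).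
Proof.
rewrite /= /cr_proj_fun raddf_sum; apply: eq_bigr => B _.
by rewrite raddfMz nt_tmap.
Qed.

Lemma cr_hom_pull a b (u : opmor P a b) x :
  cr_add a (cr_pull unP T u x) = cr_pull unP T' u (cr_add b x).
Proof. by apply: cr_val_inj; rewrite [RHS]cr_pullE -nt_tmap -nt_cr_proj. Qed.

Definition cr_hom : pm_hom (cr_mackey unP T) (cr_mackey unP T') :=
  @PMHom _ _ (cr_mackey unP T) (cr_mackey unP T') cr_add cr_hom_push cr_hom_pull.

End CrossEffectMap.

Definition cr_functor : functor (Func (Free P) Ab) (PMack unP).
Proof.
exists (fun T => cr_mackey unP T) (@cr_hom); split=> [T|T T' T'' s t];
  by apply: pm_hom_eq => n x; apply: cr_val_inj.
Defined.

Section AssemblyMap.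
Variables (M N : pmackey unP) (s : pm_hom M N).

Definition assembly_hom_fun n (x : assembly_obj M n) : assembly_obj N n := fun K => s #|K| (x K).

Lemma assembly_hom_additive n : zmod_morphism (@assembly_hom_fun n).
Proof.
by move=> x y; apply: functional_extensionality_dep => K; rewrite dprodB /assembly_hom_fun dprodB raddfB.
Qed.

HB.instance Definition _ n :=
  GRing.isZmodMorphism.Build _ _ (@assembly_hom_fun n) (@assembly_hom_additive n).

Definition assembly_add n : {additive assembly_obj M n -> assembly_obj N n} := @assembly_hom_fun n.

Lemma pm_pushS n m (f : 'I_n -> 'I_m) (K : {set 'I_n}) (L : {set 'I_m}) x :
  s #|L| (pushS M f K L x) = pushS N f K L (s #|K| x).
Proof. by rewrite /pushS; case: pselect => e; rewrite ?pm_push ?raddf0. Qed.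

Lemma pm_pullS n m (u : smor P n m) (K : {set 'I_n}) (L : {set 'I_m}) x :
  s #|K| (pullS M u K L x) = pullS N u K L (s #|L| x).
Proof. by rewrite /pullS; case: pselect => e; rewrite ?pm_pull ?raddf0. Qed.

Lemma assembly_add_natural n m (al : alg_hom (Fr 'I_n) (Fr 'I_m)) x :
  assembly_add m (assembly_map M al x) = assembly_map N al (assembly_add n x).
Proof.
have [k [g [u ->]]] := span_exists al; rewrite !assembly_mapE.
apply: functional_extensionality_dep => L.
rewrite /= /assembly_hom_fun /tpush_fun raddf_sum; apply: eq_bigr => K _.
by rewrite pm_pushS /tpull_fun pm_pullS.
Qed.

Definition assembly_hom : nat_trans (assembly M) (assembly N).
Proof.
exists assembly_add => n m al; apply: additive_eq => x; exact: assembly_add_natural.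
Defined.

End AssemblyMap.

Definition assembly_functor : functor (PMack unP) (Func (Free P) Ab).
Proof.
exists (fun M => assembly M) (@assembly_hom); split=> [M|M N L s t];
  by apply: nat_trans_eq => n; apply: additive_eq => x.
Defined.

Section Counit.
Variable T : functor (Free P) Ab.
Local Notation M := (cr_mackey unP T).

Definition eps_fun n (x : assembly_obj M n) : tobj T n :=
  \sum_(K : {set 'I_n}) tmap T (fpush P (@incl _ K)) (cr_val (x K)).

Lemma eps_additive n : zmod_morphism (@eps_fun n).
Proof.
move=> x y; rewrite /eps_fun -sumrB; apply: eq_bigr => K _.
by rewrite dprodB cr_valB raddfB.
Qed.

HB.instance Definition _ n :=
  GRing.isZmodMorphism.Build _ _ (@eps_fun n) (@eps_additive n).

Definition eps_add n : {additive assembly_obj M n -> tobj T n} := @eps_fun n.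

(** If [K] is not inside [L], restricting to [L] kills a proper part of [K],
    hence the cross effect. If [K] is strictly inside [L], the composite is
    induced by a map that is not surjective, which the projection kills. *)
Lemma cr_orthogonal n (K L : {set 'I_n}) x : K != L -> x \in cr_pred unP T #|K| ->
  cr_proj unP T #|L| (tmap T (fpull (sincl unP L)) (tmap T (fpush P (@incl _ K)) x)) = 0.
Proof.
move=> KL /crP x0; have [sKL|nKL] := boolP (K \subset L); last first.
  have -> : fpull (sincl unP L) = alg_cmp (fpull (sincl unP L)) (rho unP L).
    by rewrite -rho_incl; apply: alg_hom_eq => y; rewrite !alg_cmpE -[RHS]alg_cmpE sincl_inclK.
  rewrite -tmap_comp; have -> :
      alg_cmp (alg_cmp (fpull (sincl unP L)) (rho unP L)) (fpush P (@incl _ K)) =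
      alg_cmp (fpull (sincl unP L)) (alg_cmp (rho unP L) (fpush P (@incl _ K))).
    exact: alg_hom_eq.
  rewrite rho_fpush !tmap_comp x0 ?raddf0 //; apply: contraNN nKL => /eqP LT.
  apply/subsetP => y /inclP[k <-]; have : k \in @incl _ K @^-1: L by rewrite LT inE.
  by rewrite inE.
have /(_ _)/inclP/cid kL k : @incl _ K k \in L by apply: (subsetP sKL); apply: incl_in.
pose j k := projT1 (kL k).
have jE k : @incl _ L (j k) = @incl _ K k by exact: projT2 (kL k).
have -> : fpush P (@incl _ K) = alg_cmp (fpush P (@incl _ L)) (fpush P j).
  by rewrite -fpush_comp; congr fpush; apply: funext => k /=; rewrite jE.
rewrite tmap_comp -tmap_comp sincl_inclK tmap_id cr_proj_fpush //.
apply: contraNN KL => /surjP js; rewrite eqEsubset sKL; apply/subsetP => y /inclP[l <-].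
by have [k <-] := js l; rewrite jE incl_in.
Qed.

(** The components of a decomposition are recovered by restricting and
    projecting; in particular they are unique. *)
Lemma eps_component n (x : assembly_obj M n) (L : {set 'I_n}) :
  cr_proj unP T #|L| (tmap T (fpull (sincl unP L)) (eps_add n x)) = cr_val (x L).
Proof.
rewrite [eps_add n x]/(eps_fun x) /eps_fun (bigD1 L) //= !raddfD -tmap_comp sincl_inclK tmap_id.
rewrite cr_proj_id ?cr_valP // !raddf_sum big1 ?addr0 // => K KL.
exact: cr_orthogonal KL (cr_valP _).
Qed.

Lemma eps_inj n : injective (eps_add n).
Proof.
move=> x y e; apply: functional_extensionality_dep => L; apply: cr_val_inj.
by rewrite -eps_component e eps_component.
Qed.

Lemma eps_surj n (y : tobj T n) : exists x, eps_add n x = y.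
Proof.
exists (fun K => Cr (cr_proj_in unP (tmap T (fpull (sincl unP K)) y))).
by rewrite [RHS](cr_decomposition unP).
Qed.

Lemma eps_tpush n m (f : 'I_n -> 'I_m) x :
  eps_add m (tpush M f x) = tmap T (fpush P f) (eps_add n x).
Proof.
rewrite /= /eps_fun raddf_sum.
rewrite [RHS](partition_big (fun K : {set 'I_n} => f @: K) predT) //=.
apply: eq_bigr => L _; rewrite /tpush_fun cr_val_sum raddf_sum.
apply: eq_bigr => K /eqP <-; have [h hE] := omor_restr_exists f K.
rewrite (pushSE M hE) -[push M h (x K)]/(cr_push unP T h (x K)) cr_pushE -!tmap_comp.
by rewrite -!fpush_comp hE.
Qed.

(** It suffices to compare components. Restriction to [K] after [u] factors as
    the restriction of [u] after restriction to [u @: K], and the projection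
    may be inserted between them. *)
Lemma eps_tpull n m (u : smor P n m) x :
  eps_add n (tpull M u x) = tmap T (fpull u) (eps_add m x).
Proof.
rewrite [RHS](cr_decomposition unP) /= {1}/eps_fun; apply: eq_bigr => K _.
congr (tmap _ _ _); have [v vE] := smor_restr unP u K.
rewrite /tpull_fun (pullSE M vE) -[pull M v _]/(cr_pull unP T v _) cr_pullE.
rewrite -eps_component cr_proj_fpull ?(valP v) // -!tmap_comp -!fpull_comp vE.
by [].
Qed.

Lemma eps_natural n m (al : alg_hom (Fr 'I_n) (Fr 'I_m)) x :
  eps_add m (assembly_map M al x) = tmap T al (eps_add n x).
Proof.
have [k [g [u ->]]] := span_exists al.
by rewrite assembly_mapE eps_tpush eps_tpull tmap_comp.
Qed.

Definition eps : nat_trans (assembly M) T.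
Proof. exists eps_add => n m al; apply: additive_eq => x; exact: eps_natural. Defined.

End Counit.

Section Unit.
Variable M : pmackey unP.
Local Notation AM := (assembly M).

Lemma incl_setT_bij n : bijective (@incl n setT).
Proof.
apply: inj_card_bij; first exact: incl_inj.
by rewrite !card_ord cardsT card_ord.
Qed.

(** The full subset of ['I_n] has [n] elements only up to a propositional
    equality; [M] of the full subset and [M n] are identified by the double
    isomorphism given by its enumeration. *)
Definition top_iso n : omor #|[set: 'I_n]| n := obij (incl_setT_bij n).
Definition top_isoP n : opmor P #|[set: 'I_n]| n := opbij P (incl_setT_bij n).

Lemma top_isoPE n : opmap (top_isoP n) = sincl unP setT.
Proof.
by apply: (@inj_smor_eq _ unP) => //; [exact: inj_sbij | exact: inj_sincl].
Qed.

Lemma push_top_isoK n (x : M n) : push M (top_iso n) (pull M (top_isoP n) x) = x.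
Proof. exact: push_pull_bij. Qed.

Lemma push_top_iso_inj n : injective (push M (top_iso n)).
Proof.
have [j iK jK] := incl_setT_bij n.
have jb : bijective j by exists (@incl n setT).
apply: (can_inj (g := push M (obij jb))) => x; rewrite -push_comp.
have -> : ocomp (obij jb) (top_iso n) = oid _ by apply: val_inj; apply: funext => k /=; apply: iK.
exact: push_id.
Qed.

Lemma pull_top_isoK n (x : M #|[set: 'I_n]|) :
  pull M (top_isoP n) (push M (top_iso n) x) = x.
Proof. by apply: push_top_iso_inj; rewrite push_top_isoK. Qed.

Lemma tpull_top n (K : {set 'I_n}) (x : assembly_obj M n) :
  tpull M (sincl unP K) x = 0 -> x K = 0.
Proof.
move=> /(congr1 (fun y => y setT)); rewrite /= /tpull_fun.
have iK : @incl _ K @: setT = K.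
  by apply/setP => y; apply/imsetP/inclP => [[i _ ->]|[i <-]]; exists i.
rewrite [sincl unP K @: _]iK (@pullSE _ _ M _ _ _ _ _ (top_isoP _)); last first.
  by rewrite top_isoPE.
by move=> e; rewrite -[x K]push_top_isoK e; apply: raddf0.
Qed.

Lemma tmap_assembly n m (al : alg_hom (Fr 'I_n) (Fr 'I_m)) x : tmap AM al x = assembly_map M al x.
Proof. by []. Qed.

Lemma tpull_tpush_incl n (K : {set 'I_n}) x :
  tpull M (sincl unP K) (tpush M (@incl _ K) x) = x.
Proof.
by rewrite -assembly_map_fpush -assembly_map_fpull -assembly_map_comp sincl_inclK assembly_map_id.
Qed.

(** The component at [K] is detected by restricting to [K], which factors
    through [T(rho K)]. *)
Lemma cr_assemblyP n (x : assembly_obj M n) :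
  reflect (forall K, K != setT -> x K = 0) (x \in cr_pred unP AM n).
Proof.
apply: (iffP (@crP P unP AM n x)) => [x0 K KT|x0 B BT].
  apply: tpull_top; rewrite -[LHS]tpull_tpush_incl -assembly_mapE rho_incl.
  by rewrite -tmap_assembly (x0 K KT) raddf0.
rewrite tmap_assembly -rho_incl assembly_mapE.
have -> : tpull M (sincl unP B) x = 0; last by rewrite raddf0.
apply: functional_extensionality_dep => K; rewrite /= /tpull_fun x0 ?raddf0 //.
apply: contraNneq BT => iK; rewrite eqEsubset subsetT -iK.
by apply/subsetP => y /imsetP[k _ ->]; apply: incl_in.
Qed.

Definition eta_fun n (x : cr unP AM n) : M n := push M (top_iso n) ((cr_val x : assembly_obj M n) setT).

Lemma eta_additive n : zmod_morphism (@eta_fun n).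
Proof. by move=> x y; rewrite /eta_fun cr_valB dprodB raddfB. Qed.

HB.instance Definition _ n :=
  GRing.isZmodMorphism.Build _ _ (@eta_fun n) (@eta_additive n).

Definition eta_add n : {additive cr unP AM n -> M n} := @eta_fun n.

Lemma surjb_imsetT n m (f : 'I_n -> 'I_m) : surjb f -> f @: setT = setT.
Proof.
move=> /surjP fs; apply/setP => y; rewrite inE; apply/imsetP.
by have [x <-] := fs y; exists x.
Qed.

Lemma eta_push n m (f : omor n m) x :
  eta_add m (cr_push unP AM f x) = push M f (eta_add n x).
Proof.
rewrite /= /eta_fun cr_pushE; set y : assembly_obj M n := cr_val x.
rewrite tmap_assembly assembly_map_fpush /= /tpush_fun.
have fT := surjb_imsetT (valP f).
rewrite (bigD1 setT) /=; last by rewrite fT.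
rewrite big1 ?addr0 => [|K /andP[_ KT]]; last first.
  by have /cr_assemblyP x0 := cr_valP x; rewrite [y K]x0 ?raddf0.
have [h hE] := omor_restr_exists (omap f) setT.
move: h hE; rewrite fT => h hE; rewrite (pushSE M hE) -!push_comp.
congr (push M _ _); apply: val_inj; exact: hE.
Qed.

Definition top_eval n : {additive assembly_obj M n -> M #|[set: 'I_n]|} :=
  @dprod_eval _ (fun K : {set 'I_n} => M #|K|) setT.

Lemma tpush_top n m (f : 'I_n -> 'I_m) x : f @: setT != setT -> top_eval m (tpush M f x) = 0.
Proof.
move=> fT; rewrite /= /dprod_eval /tpush_fun big_pred0 // => K; apply/negbTE.
apply: contraNneq fT => fK; rewrite eqEsubset subsetT -fK; exact/imsetS/subsetT.
Qed.

(** The corrections that the projection adds are pushed forward from proper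
    subsets, so that they have no component at the full subset. *)
Lemma cr_proj_top n (y : assembly_obj M n) : top_eval n (cr_proj unP AM n y) = top_eval n y.
Proof.
rewrite (@cr_projE P unP AM n y) raddfD raddf_sum big1 ?addr0 // => B BT.
rewrite raddfMz tmap_assembly -rho_incl assembly_mapE.
rewrite tpush_top ?mul0rz //; apply: contraNneq BT => iT; rewrite eqEsubset subsetT -iT.
by apply/subsetP => b /imsetP[k _ ->]; apply: incl_in.
Qed.

Lemma eta_pull n m (u : opmor P n m) x :
  eta_add n (cr_pull unP AM u x) = pull M u (eta_add m x).
Proof.
rewrite /= /eta_fun cr_pullE; set y : assembly_obj M m := cr_val x.
rewrite tmap_assembly assembly_map_fpull.
have -> : (cr_proj unP AM n (tpull M (opmap u) y) : assembly_obj M n) setT =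
    tpull M (opmap u) y setT := cr_proj_top _.
rewrite /= /tpull_fun; have uT := surjb_imsetT (valP u).
have [v vE] := smor_restr unP (opmap u) setT.
move: v vE; rewrite [opmap u @: _]uT => v vE; rewrite (pullSE M vE).
rewrite -{1}[y setT]pull_top_isoK -pull_comp.
have -> : opcomp (top_isoP m) v = opcomp u (top_isoP n).
  by apply: val_inj; rewrite -[LHS]/(scomp (opmap (top_isoP m)) (opmap v)) top_isoPE vE -top_isoPE.
by rewrite pull_comp push_top_isoK.
Qed.

Definition eta : pm_hom (cr_mackey unP AM) M :=
  @PMHom _ _ (cr_mackey unP AM) M eta_add eta_push eta_pull.

Lemma eta_inj n : injective (eta n).
Proof.
move=> x y /push_top_iso_inj e; apply: cr_val_inj; apply: functional_extensionality_dep => K.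
have [->|KT] := eqVneq K setT; first exact: e.
have /cr_assemblyP x0 := cr_valP x; have /cr_assemblyP y0 := cr_valP y.
by rewrite x0 // y0.
Qed.

Lemma eta_surj n y : exists x, eta n x = y.
Proof.
pose x : assembly_obj M n := fun K => match pselect (setT = K) with
  | left e => eq_rect setT (fun K : {set 'I_n} => M #|K|) (pull M (top_isoP n) y) K e
  | right _ => 0
  end.
have xC : x \in cr_pred unP AM n.
  apply/cr_assemblyP => K /eqP KT; rewrite /x; case: pselect => // e.
  by case: KT.
exists (Cr xC); rewrite -[LHS]/(push M (top_iso n) (x setT)) /x.
case: pselect => // e; rewrite (Prop_irrelevance e erefl); exact: push_top_isoK.
Qed.

End Unit.

Definition eps_trans :
  nat_trans (comp_functor assembly_functor cr_functor) (id_functor (Func (Free P) Ab)).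
Proof.
exists eps => T T' s; apply: nat_trans_eq => n; apply: additive_eq => x.
rewrite -[LHS]/(eps_fun (assembly_hom_fun (cr_hom s) x)) -[RHS]/(nt_add s n (eps_fun x)).
rewrite /eps_fun raddf_sum; apply: eq_bigr => K _.
by rewrite nt_tmap.
Defined.

Definition eta_trans :
  nat_trans (comp_functor cr_functor assembly_functor) (id_functor (PMack unP)).
Proof.
exists eta => M N s; apply: pm_hom_eq => n x; exact/esym/(pm_push s).
Defined.

End Equivalence.

Theorem theorem0p1 (P : operad) (unP : unitary P) :
  equivalent (Func (Free P) Ab) (PMack unP).
Proof.
exists (cr_functor unP), (assembly_functor unP); split.
  apply: (@nat_isoP _ _ _ _ (eps_trans unP)) => T.
  by have [s [st ts]] := @func_ab_iso (Free P) _ _ (eps unP T) (@eps_inj _ unP T) (@eps_surj _ unP T); exists s.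
apply: (@nat_isoP _ _ _ _ (eta_trans unP)) => M.
by have [s [st ts]] := @pmack_iso _ unP _ _ (eta M) (@eta_inj _ _ M) (@eta_surj _ _ M); exists s.
Qed.
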